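(* Let $d_1,d_2,d_3,J,K$ be positive integers with $J\le d_1$, $K\le d_3$, and $T$ a positive integer. Let $\mathcal Y=\mathcal T^*+\mathcal E\in\mathbb R^{d_1\times d_2\times d_3}$, where $\mathcal T^*=U^*\times_1V^*\times_3\mathcal W^*$ with $U^*\in\mathbb O_{d_1,J}$, $V^*\in\mathbb O_{d_3,K}$, $\mathcal W^*\in\mathbb R^{J\times d_2\times K}$, and $\mathcal E$ is arbitrary. Let $\widehat{\mathcal T}$ be the output of HardTTh applied to $\mathcal Y$ with ranks $(J,K)$ and $T$ iterations. Suppose $$\sigma_J(\mathtt m_1(\mathcal T^* ))\ge24\|\mathtt m_1(\mathcal E)\|\quad\text{and}\quad\sigma_K(\mathtt m_3(\mathcal T^* ))\ge24\sup_{U\in\mathbb R^{d_1\times J},\|U\|\le1}\|\mathtt m_3(\mathcal E)(U\otimes I_{d_2})\|.$$ Put $\alpha_U=\|\mathtt m_1((V^* )^\top\times_3\mathcal E)\|$, $\beta_U=\sup_{V\in\mathbb R^{d_3\times K},\|V\|\le1}\|\mathtt m_1(V^\top\times_3\mathcal E)\|$, $\alpha_V=\|\mathtt m_3((U^* )^\top\times_1\mathcal E)\|$, $\beta_V=\sup_{U\in\mathbb R^{d_1\times J},\|U\|\le1}\|\mathtt m_3(U^\top\times_1\mathcal E)\|$. Then $$\|\widehat{\mathcal T}-\mathcal T^*\|_{\rm F}\le\sup_{U\in\mathbb O_{d_1,J},V\in\mathbb O_{d_3,K}}\|U^\top\times_1V^\top\times_3\mathcal E\|_{\rm F}+4\sqrt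 K\alpha_V+4\sqrt J\alpha_U+\diamondsuit_2+r_T,$$ where $$\diamondsuit_2=48\Big(\frac{\sqrt K\beta_V\alpha_U}{\sigma_J(\mathtt m_1(\mathcal T^* ))}+\frac{\sqrt J\beta_U\alpha_V}{\sigma_K(\mathtt m_3(\mathcal T^* ))}\Big),\qquad r_T=3(\sqrt J+\sqrt K)\Big(\frac{64\beta_V\beta_U}{\sigma_J(\mathtt m_1(\mathcal T^* ))\sigma_K(\mathtt m_3(\mathcal T^* ))}\Big)^T\|\mathtt m_1(\mathcal E)\|.$$
   Context: Notation: $\|M\|$ is the spectral norm, $\|\cdot\|_{\rm F}$ the Frobenius norm (for tensors: Euclidean norm of all entries), $\sigma_k(M)$ the $k$-th largest singular value, $I_m$ the identity of size $m$, $\otimes$ the Kronecker product. $\mathbb O_{a,b}$ is the set of $a\times b$ real matrices with orthonormal columns. Mode products: for $\mathcal T\in\mathbb R^{n_1\times n_2\times n_3}$ and $M\in\mathbb R^{m\times n_i}$, $M\times_i\mathcal T$ replaces the $i$-th index: $(M\times_1\mathcal T)_{abc}=\sum_{a'}M_{aa'}\mathcal T_{a'bc}$, $(M\times_3\mathcal T)_{abc}=\sum_{c'}M_{cc'}\mathcal T_{abc'}$; $A\times_1B\times_3\mathcal T$ means $A\times_1(B\times_3\mathcal T)$. Unfoldings: for $\mathcal T\in\mathbb R^{n_1\times n_2\times n_3}$, $\mathtt m_1(\mathcal T)\in\mathbb R^{n_1\times n_2n_3}$ with $\mathtt m_1(\mathcal T)_{a,(b-1)n_3+c}=\mathcal T_{abc}$,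 and $\mathtt m_3(\mathcal T)\in\mathbb R^{n_3\times n_1n_2}$ with $\mathtt m_3(\mathcal T)_{c,(a-1)n_2+b}=\mathcal T_{abc}$. HardTTh (input $\mathcal Y\in\mathbb R^{d_1\times d_2\times d_3}$, ranks $(J,K)$, $T$): let $\widehat U_0\in\mathbb O_{d_1,J}$ consist of $J$ leading left singular vectors of $\mathtt m_1(\mathcal Y)$ and $\widehat V_0\in\mathbb O_{d_3,K}$ of $K$ leading left singular vectors of $\mathtt m_3(\widehat U_0^\top\times_1\mathcal Y)$; for $t=1,\dots,T$, let $\widehat U_t$ consist of $J$ leading left singular vectors of $\mathtt m_1(\widehat V_{t-1}^\top\times_3\mathcal Y)$ and $\widehat V_t$ of $K$ leading left singular vectors of $\mathtt m_3(\widehat U_t^\top\times_1\mathcal Y)$. Set $\widehat U=\widehat U_T$, $\widehat V=\widehat V_T$, $\widehat{\mathcal W}=\widehat U^\top\times_1\widehat V^\top\times_3\mathcal Y$, output $\widehat{\mathcal T}=\widehat U\times_1\widehat V\times_3\widehat{\mathcal W}$. *)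

(* Defs.v *)
From HB Require Import structures.
From mathcomp Require Import all_boot all_order all_algebra.
From mathcomp Require Import mxtens.
From mathcomp Require Import boolp classical_sets reals.

Set Implicit Arguments.
Unset Strict Implicit.
Unset Printing Implicit Defensive.

Import Order.TTheory GRing.Theory Num.Theory.
Local Open Scope ring_scope.
Local Open Scope classical_set_scope.

Section Tensors.
Variable R : realType.

Definition tensor (n1 n2 n3 : nat) := 'I_n1 -> 'I_n2 -> 'I_n3 -> R.

Definition tadd n1 n2 n3 (X Y : tensor n1 n2 n3) : tensor n1 n2 n3 :=
  fun a b c => X a b c + Y a b c.
Definition tsub n1 n2 n3 (X Y : tensor n1 n2 n3) : tensor n1 n2 n3 :=
  fun a b c => X a b c - Y a b c.

Definition mode1 m n1 n2 n3 (M : 'M[R]_(m, n1)) (X : tensor n1 n2 n3)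
  : tensor m n2 n3 := fun a b c => \sum_(a' < n1) M a a' * X a' b c.
Definition mode3 m n1 n2 n3 (M : 'M[R]_(m, n3)) (X : tensor n1 n2 n3)
  : tensor n1 n2 m := fun a b c => \sum_(c' < n3) M c c' * X a b c'.

(** Unfoldings.  [mxtens_index (b, c)] is the column index b * n3 + c
    (0-based), i.e. the paper's (b-1) n3 + c. *)
Definition unfold1 n1 n2 n3 (X : tensor n1 n2 n3) : 'M[R]_(n1, n2 * n3) :=
  \matrix_(a, j) X a (mxtens_unindex j).1 (mxtens_unindex j).2.
Definition unfold3 n1 n2 n3 (X : tensor n1 n2 n3) : 'M[R]_(n3, n1 * n2) :=
  \matrix_(c, j) X (mxtens_unindex j).1 (mxtens_unindex j).2 c.

Definition mxfnorm m n (A : 'M[R]_(m, n)) : R :=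
  Num.sqrt (\sum_(i < m) \sum_(j < n) A i j ^+ 2).
Definition tfnorm n1 n2 n3 (X : tensor n1 n2 n3) : R :=
  Num.sqrt (\sum_(a < n1) \sum_(b < n2) \sum_(c < n3) X a b c ^+ 2).

Definition specnorm m n (A : 'M[R]_(m, n)) : R :=
  sup [set mxfnorm (A *m x) | x in [set x : 'cV[R]_n | mxfnorm x <= 1]].

Definition orthonormal_cols m k (U : 'M[R]_(m, k)) : Prop := U^T *m U = 1%:M.

Definition is_svd m n (M : 'M[R]_(m, n)) (P : 'M[R]_m) (S : 'M[R]_(m, n))
  (Q : 'M[R]_n) : Prop :=
  [/\ P^T *m P = 1%:M /\ Q^T *m Q = 1%:M, M = P *m S *m Q^T,
      (forall (i : 'I_m) (j : 'I_n), (i : nat) <> j -> S i j = 0),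
      (forall (i : 'I_m) (j : 'I_n), (i : nat) = j -> 0 <= S i j) &
      (forall (i i' : 'I_m) (j j' : 'I_n), (i : nat) = j -> (i' : nat) = j' ->
         (i <= i')%N -> S i' j' <= S i j)].

(** The (k+1)-th diagonal entry of S (0 when out of range). *)
Definition diag_entry m n (S : 'M[R]_(m, n)) (k : nat) : R :=
  \sum_(i < m) \sum_(j < n) (if ((i : nat) == k) && ((j : nat) == k)
                             then S i j else 0).

(** k-th largest singular value sigma_k(M) (k >= 1), read off any SVD of M
    (singular values do not depend on the chosen SVD); 0 if k > min(m,n). *)
Definition sing_val m n (M : 'M[R]_(m, n)) (k : nat) : R :=
  sup [set s | exists P S Q, is_svd M P S Q /\ s = diag_entry S k.-1].

Definition leading_lsv m n k (M : 'M[R]_(m, n)) (U : 'M[R]_(m, k)) : Prop :=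
  exists P S Q, is_svd M P S Q /\ U = P *m pid_mx k.

Definition hardtth_output d1 d2 d3 (Y : tensor d1 d2 d3) (J K T : nat)
  (That : tensor d1 d2 d3) : Prop :=
  exists (Uh : nat -> 'M[R]_(d1, J)) (Vh : nat -> 'M[R]_(d3, K)),
    [/\ leading_lsv (unfold1 Y) (Uh 0%N),
        leading_lsv (unfold3 (mode1 (Uh 0%N)^T Y)) (Vh 0%N),
        (forall t, (1 <= t <= T)%N ->
           leading_lsv (unfold1 (mode3 (Vh t.-1)^T Y)) (Uh t) /\
           leading_lsv (unfold3 (mode1 (Uh t)^T Y)) (Vh t)) &
        That = mode1 (Uh T) (mode3 (Vh T)
                 (mode1 (Uh T)^T (mode3 (Vh T)^T Y)))].

End Tensors.

(* Main.v *)
Require Import Defs.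
From HB Require Import structures.
From mathcomp Require Import all_boot all_order all_algebra.
From mathcomp Require Import mxtens.
From mathcomp Require Import boolp classical_sets reals.
From mathcomp Require Import ring lra zify.

Import Order.TTheory GRing.Theory Num.Theory.
Local Open Scope ring_scope.
Local Open Scope classical_set_scope.

(** Write P_U = U U^T.  If [U] collects leading left singular vectors of [A + Z]
    with [A] of rank at most [k], then (1 - P_U) A is at most twice [Z], both in
    spectral and in (rank-[k]) Frobenius norm.  Applied to the unfoldings, this
    bounds u_t = ||(1 - P_{U_t}) m1(Ts)|| and v_t = ||(1 - P_{V_t}) m3(Ts)||,
    and u_t / sJ, v_t / sK control the sines of the angles to [Us], [Vs].  Splitting
    [V^T] into a part factoring through [Vs^T] and a part of the size of the sine
    yields, with kappa = 2 (101/100)^2 = 10201/5000,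
      v_t <= kappa (alphaV + betaV u_t / sJ),
      u_(t+1) <= kappa (alphaU + betaU v_t / sK),
    an affine recursion whose ratio kappa^2 betaU betaV / (sJ sK) is below 1/101.
    The error is the projected noise plus the two residuals; the residual of the
    last [V] is estimated directly in Frobenius norm.  If sJ or sK vanishes, then
    so does [E], and the recovery is exact. *)

Set Implicit Arguments.
Unset Strict Implicit.
Unset Printing Implicit Defensive.

(** * Frobenius inner product and norm of matrices *)

Section FrobeniusNorm.
Variable R : realType.
Implicit Types m n p : nat.

(** Frobenius inner product. The trace form makes moving a factor to the other side, as in
    [mxdot_mull], plain associativity. *)
Definition mxdot m n (A B : 'M[R]_(m, n)) : R := \tr (A^T *m B).

Lemma mxdotE m n (A B : 'M[R]_(m, n)) :
  mxdot A B = \sum_i \sum_j A i j * B i j.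
Proof.
rewrite exchange_big; apply: eq_bigr => j _; rewrite mxE.
by apply: eq_bigr => i _; rewrite mxE.
Qed.

Lemma mxdotC m n (A B : 'M[R]_(m, n)) : mxdot A B = mxdot B A.
Proof. by rewrite /mxdot -mxtrace_tr trmx_mul trmxK. Qed.

Lemma mxdotDr m n (A B C : 'M[R]_(m, n)) :
  mxdot A (B + C) = mxdot A B + mxdot A C.
Proof. by rewrite /mxdot mulmxDr linearD. Qed.

Lemma mxdotDl m n (A B C : 'M[R]_(m, n)) :
  mxdot (A + B) C = mxdot A C + mxdot B C.
Proof. by rewrite mxdotC mxdotDr !(mxdotC C). Qed.

Lemma mxdotZr m n a (A B : 'M[R]_(m, n)) : mxdot A (a *: B) = a * mxdot A B.
Proof. by rewrite /mxdot -scalemxAr linearZ. Qed.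

Lemma mxdotZl m n a (A B : 'M[R]_(m, n)) : mxdot (a *: A) B = a * mxdot A B.
Proof. by rewrite mxdotC mxdotZr mxdotC. Qed.

Lemma mxdot_mull m n p (M : 'M[R]_(m, p)) A (B : 'M[R]_(m, n)) :
  mxdot (M *m A) B = mxdot A (M^T *m B).
Proof. by rewrite /mxdot trmx_mul mulmxA. Qed.

Lemma mxfnorm_ge0 m n (A : 'M[R]_(m, n)) : 0 <= mxfnorm A.
Proof. exact: sqrtr_ge0. Qed.

Lemma mxfnorm_sqr m n (A : 'M[R]_(m, n)) : mxfnorm A ^+ 2 = mxdot A A.
Proof.
rewrite sqr_sqrtr; last by do 2![apply: sumr_ge0 => ? _]; apply: sqr_ge0.
by rewrite mxdotE; do 2![apply: eq_bigr => ? _]; rewrite expr2.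
Qed.

Lemma mxdot_ge0 m n (A : 'M[R]_(m, n)) : 0 <= mxdot A A.
Proof. by rewrite -mxfnorm_sqr sqr_ge0. Qed.

Lemma ler_mxfnorm m n p q (A : 'M[R]_(m, n)) (B : 'M[R]_(p, q)) :
  (mxfnorm A <= mxfnorm B) = (mxdot A A <= mxdot B B).
Proof. by rewrite -!mxfnorm_sqr ler_sqr ?nnegrE ?mxfnorm_ge0. Qed.

Lemma mxfnorm_eqP m n p q (A : 'M[R]_(m, n)) (B : 'M[R]_(p, q)) :
  mxdot A A = mxdot B B -> mxfnorm A = mxfnorm B.
Proof. by move=> eAB; apply/eqP; rewrite eq_le !ler_mxfnorm eAB lexx. Qed.

Lemma mxfnorm0 m n : mxfnorm (0 : 'M[R]_(m, n)) = 0.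
Proof. by apply/eqP; rewrite -sqrf_eq0 mxfnorm_sqr /mxdot mulmx0 linear0. Qed.

Lemma mxfnorm_eq0 m n (A : 'M[R]_(m, n)) : (mxfnorm A == 0) = (A == 0).
Proof.
apply/eqP/eqP => [A0|->]; last exact: mxfnorm0.
have := mxfnorm_sqr A; rewrite A0 expr0n mxdotE /= => /esym/eqP.
rewrite psumr_eq0 => [/allP s0|i _]; last first.
  by apply: sumr_ge0 => j _; rewrite -expr2 sqr_ge0.
apply/matrixP => i j; have := s0 i (mem_index_enum i).
rewrite /= psumr_eq0 => [/allP/(_ j (mem_index_enum j))|k _]; last first.
  by rewrite -expr2 sqr_ge0.
by rewrite /= -expr2 sqrf_eq0 mxE => /eqP.
Qed.

Lemma mxfnormZ m n a (A : 'M[R]_(m, n)) : mxfnorm (a *: A) = `|a| * mxfnorm A.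
Proof.
apply/eqP; rewrite -(@eqrXn2 _ 2) ?mulr_ge0 ?mxfnorm_ge0 //.
by rewrite exprMn real_normK ?num_real // !mxfnorm_sqr mxdotZl mxdotZr mulrA.
Qed.

Lemma mxfnormN m n (A : 'M[R]_(m, n)) : mxfnorm (- A) = mxfnorm A.
Proof. by rewrite -scaleN1r mxfnormZ normrN1 mul1r. Qed.

Lemma mxfnorm_tr m n (A : 'M[R]_(m, n)) : mxfnorm A^T = mxfnorm A.
Proof. by apply: mxfnorm_eqP; rewrite /mxdot trmxK mxtrace_mulC. Qed.

(** Cauchy-Schwarz: expand the nonnegative square of ||B|| A - ||A|| B. Dividing by ||A|| ||B||
    requires the zero cases to be treated apart. *)
Lemma mxdot_le m n (A B : 'M[R]_(m, n)) : mxdot A B <= mxfnorm A * mxfnorm B.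
Proof.
have [->|B0] := eqVneq B 0.
  by rewrite mxfnorm0 mulr0 /mxdot mulmx0 linear0.
have nB : 0 < mxfnorm B by rewrite lt_def mxfnorm_eq0 B0 mxfnorm_ge0.
have := mxdot_ge0 (mxfnorm B *: A + (- mxfnorm A) *: B).
rewrite !(mxdotDl, mxdotDr, mxdotZl, mxdotZr) -!mxfnorm_sqr (mxdotC B A).
move=> h; case: (ler0P (mxfnorm A)) => [A0|A0]; last first.
  rewrite -subr_ge0 -(pmulr_rge0 _ (mulr_gt0 A0 nB)).
  by move: (mxdot A B) (mxfnorm A) (mxfnorm B) h => *; lra.
have /eqP: mxfnorm A = 0 by apply/eqP; rewrite eq_le A0 mxfnorm_ge0.
rewrite mxfnorm_eq0 => /eqP ->.
by rewrite mxfnorm0 mul0r mxdotC /mxdot mulmx0 linear0.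
Qed.

Lemma mxfnormD m n (A B : 'M[R]_(m, n)) :
  mxfnorm (A + B) <= mxfnorm A + mxfnorm B.
Proof.
rewrite -ler_sqr ?nnegrE ?addr_ge0 ?mxfnorm_ge0 //.
rewrite mxfnorm_sqr !(mxdotDl, mxdotDr) (mxdotC B) -!mxfnorm_sqr.
by have := mxdot_le A B; lra.
Qed.

Lemma mxfnormB m n (A B : 'M[R]_(m, n)) :
  mxfnorm (A - B) <= mxfnorm A + mxfnorm B.
Proof. by rewrite -(mxfnormN B) mxfnormD. Qed.

Lemma mxfnorm_col m n (A : 'M[R]_(m, n)) :
  mxfnorm A ^+ 2 = \sum_j mxfnorm (col j A) ^+ 2.
Proof.
rewrite mxfnorm_sqr mxdotE exchange_big; apply: eq_bigr => j _ /=.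
rewrite mxfnorm_sqr mxdotE; apply: eq_bigr => i _.
by rewrite big_ord1 !mxE.
Qed.

Lemma mxfnorm_row m n (A : 'M[R]_(m, n)) :
  mxfnorm A ^+ 2 = \sum_i mxfnorm (row i A) ^+ 2.
Proof.
rewrite -mxfnorm_tr mxfnorm_col; apply: eq_bigr => i _.
by rewrite -tr_row mxfnorm_tr.
Qed.

Lemma mxfnormM m n p (A : 'M[R]_(m, n)) (B : 'M[R]_(n, p)) :
  mxfnorm (A *m B) <= mxfnorm A * mxfnorm B.
Proof.
rewrite -ler_sqr ?nnegrE ?mulr_ge0 ?mxfnorm_ge0 // mxfnorm_sqr mxdotE.
rewrite exprMn (mxfnorm_row A) (mxfnorm_col B) big_distrlr /=.
apply: ler_sum => i _; apply: ler_sum => j _.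
have eAB : (A *m B) i j = mxdot (row i A)^T (col j B).
  rewrite /mxdot trmxK trace_mx11 [LHS]mxE [RHS]mxE.
  by apply: eq_bigr => k _; rewrite !mxE.
have h1 := mxdot_le (row i A)^T (col j B).
(* The same bound for the opposite sign, so that the square of the entry is controlled. *)
have h2 := mxdot_le (- (row i A)^T) (col j B).
have h0 : 0 <= mxfnorm (row i A) * mxfnorm (col j B).
  by rewrite mulr_ge0 ?mxfnorm_ge0.
move: h1 h2; rewrite -scaleN1r mxdotZl mxfnormZ normrN1 mul1r mxfnorm_tr -eAB.
move=> h1 h2; rewrite -exprMn; set q := _ * _ in h0 h1 h2 *.
have : 0 <= (q - (A *m B) i j) * (q + (A *m B) i j) by rewrite mulr_ge0 //; lra.
lra.
Qed.

End FrobeniusNorm.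

(** * Spectral norm and its interplay with the Frobenius norm *)

Section SpectralNorm.
Variable R : realType.
Implicit Types m n p k : nat.

(** Boundedness of this set makes its [sup] an actual least upper bound. *)
Lemma specnorm_set_bound m n (A : 'M[R]_(m, n)) :
  ubound [set mxfnorm (A *m x) | x in [set x : 'cV[R]_n | mxfnorm x <= 1]]
    (mxfnorm A).
Proof.
move=> _ [x /= x1 <-]; apply: le_trans (mxfnormM _ _) _.
by rewrite ler_piMr ?mxfnorm_ge0.
Qed.

Lemma specnorm_ge0 m n (A : 'M[R]_(m, n)) : 0 <= specnorm A.
Proof.
apply: ub_le_sup; first by exists (mxfnorm A); apply: specnorm_set_bound.
by exists 0; rewrite /= ?mulmx0 mxfnorm0 // ler01.
Qed.

Lemma specnorm_cV m n (A : 'M[R]_(m, n)) (x : 'cV_n) :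
  mxfnorm (A *m x) <= specnorm A * mxfnorm x.
Proof.
have [->|x0] := eqVneq x 0; first by rewrite mulmx0 !mxfnorm0 mulr0.
have nx : 0 < mxfnorm x by rewrite lt_def mxfnorm_eq0 x0 mxfnorm_ge0.
rewrite -ler_pdivrMr //; apply: ub_le_sup.
  by exists (mxfnorm A); apply: specnorm_set_bound.
exists ((mxfnorm x)^-1 *: x); rewrite /= ?mxfnormZ ?gtr0_norm ?invr_gt0 //.
  by rewrite mulVf ?gt_eqF.
by rewrite -scalemxAr mxfnormZ gtr0_norm ?invr_gt0 // mulrC.
Qed.

Lemma specnorm_le m n (A : 'M[R]_(m, n)) c : 0 <= c ->
  (forall x : 'cV_n, mxfnorm (A *m x) <= c * mxfnorm x) -> specnorm A <= c.
Proof.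
move=> c0 Ac; apply: ge_sup.
  by exists (mxfnorm (A *m (0 : 'cV_n))), 0; rewrite //= mxfnorm0 ler01.
by move=> _ [x /= x1 <-]; apply: le_trans (Ac x) _; rewrite ler_piMr.
Qed.

Lemma specnormM m n p (A : 'M[R]_(m, n)) (B : 'M[R]_(n, p)) :
  mxfnorm (A *m B) <= specnorm A * mxfnorm B.
Proof.
rewrite -ler_sqr ?nnegrE ?mulr_ge0 ?mxfnorm_ge0 ?specnorm_ge0 //.
rewrite exprMn !mxfnorm_col mulr_sumr; apply: ler_sum => j _.
have -> : col j (A *m B) = A *m col j B by rewrite !colE mulmxA.
rewrite -exprMn.
by rewrite ler_sqr ?nnegrE ?mulr_ge0 ?mxfnorm_ge0 ?specnorm_ge0 ?specnorm_cV.
Qed.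

(** Since ||A^T x||^2 = <x, A A^T x> is at most ||x|| ||A|| ||A^T x||, one factor ||A^T x||
    cancels. *)
Lemma specnorm_tr_le m n (A : 'M[R]_(m, n)) : specnorm A^T <= specnorm A.
Proof.
apply: specnorm_le; first exact: specnorm_ge0.
move=> x; have [->|Ax0] := eqVneq (A^T *m x) 0.
  by rewrite mxfnorm0 mulr_ge0 ?specnorm_ge0 ?mxfnorm_ge0.
have nAx : 0 < mxfnorm (A^T *m x) by rewrite lt_def mxfnorm_eq0 Ax0 mxfnorm_ge0.
rewrite -(ler_pM2r nAx) -expr2 mxfnorm_sqr mxdot_mull trmxK.
apply: le_trans (mxdot_le _ _) _.
by rewrite mulrAC mulrC ler_wpM2r ?mxfnorm_ge0 // specnormM.
Qed.

Lemma specnorm_tr m n (A : 'M[R]_(m, n)) : specnorm A^T = specnorm A.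
Proof.
apply/eqP; rewrite eq_le specnorm_tr_le /=.
by have := specnorm_tr_le A^T; rewrite trmxK.
Qed.

Lemma specnormMr m n p (A : 'M[R]_(m, n)) (B : 'M[R]_(n, p)) :
  mxfnorm (A *m B) <= mxfnorm A * specnorm B.
Proof.
by rewrite -mxfnorm_tr trmx_mul mulrC -specnorm_tr -(mxfnorm_tr A) specnormM.
Qed.

Lemma specnorm_le_rV m n (A : 'M[R]_(m, n)) c : 0 <= c ->
  (forall y : 'rV_m, mxfnorm (y *m A) <= c * mxfnorm y) -> specnorm A <= c.
Proof.
move=> c0 Ac; rewrite -specnorm_tr; apply: specnorm_le => // x.
by rewrite -mxfnorm_tr trmx_mul trmxK -(mxfnorm_tr x).
Qed.

Lemma specnorm_mul m n p (A : 'M[R]_(m, n)) (B : 'M[R]_(n, p)) :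
  specnorm (A *m B) <= specnorm A * specnorm B.
Proof.
apply: specnorm_le; first by rewrite mulr_ge0 ?specnorm_ge0.
move=> x; rewrite -mulmxA; apply: le_trans (specnormM _ _) _.
by rewrite -mulrA ler_wpM2l ?specnorm_ge0 // specnormM.
Qed.

Lemma specnormD m n (A B : 'M[R]_(m, n)) :
  specnorm (A + B) <= specnorm A + specnorm B.
Proof.
apply: specnorm_le; first by rewrite addr_ge0 ?specnorm_ge0.
move=> x; rewrite mulmxDl mulrDl; apply: le_trans (mxfnormD _ _) _.
by rewrite lerD ?specnormM.
Qed.

Lemma specnormZ_le m n a (A : 'M[R]_(m, n)) :
  specnorm (a *: A) <= `|a| * specnorm A.
Proof.
apply: specnorm_le; first by rewrite mulr_ge0 ?specnorm_ge0.
by move=> x; rewrite -scalemxAl mxfnormZ -mulrA ler_wpM2l ?specnormM.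
Qed.

Lemma specnormN m n (A : 'M[R]_(m, n)) : specnorm (- A) = specnorm A.
Proof.
have h (B : 'M[R]_(m, n)) : specnorm (- B) <= specnorm B.
  by rewrite -scaleN1r (le_trans (specnormZ_le _ _)) // normrN1 mul1r.
by apply/eqP; rewrite eq_le h /= -{1}(opprK A) h.
Qed.

Lemma specnormB m n (A B : 'M[R]_(m, n)) :
  specnorm (A - B) <= specnorm A + specnorm B.
Proof. by rewrite -(specnormN B) specnormD. Qed.

Lemma specnorm0 m n : specnorm (0 : 'M[R]_(m, n)) = 0.
Proof.
apply/eqP; rewrite eq_le specnorm_ge0 andbT; apply: specnorm_le => // x.
by rewrite mul0mx mxfnorm0 mul0r.
Qed.

Lemma specnorm_le0 m n (A : 'M[R]_(m, n)) : specnorm A <= 0 -> A = 0.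
Proof.
move=> A0; apply/eqP; rewrite -mxfnorm_eq0 eq_le mxfnorm_ge0 andbT.
rewrite -(mulmx1 A); apply: le_trans (specnormM _ _) _.
by rewrite mulr_le0_ge0 ?mxfnorm_ge0.
Qed.

Lemma mxfnorm_isom m k n (U : 'M[R]_(m, k)) (A : 'M[R]_(k, n)) :
  U^T *m U = 1%:M -> mxfnorm (U *m A) = mxfnorm A.
Proof.
by move=> UU; apply: mxfnorm_eqP; rewrite mxdot_mull mulmxA UU mul1mx.
Qed.

Lemma specnorm_isom_le m k (U : 'M[R]_(m, k)) :
  U^T *m U = 1%:M -> specnorm U <= 1.
Proof.
by move=> UU; apply: specnorm_le => // x; rewrite mxfnorm_isom // mul1r.
Qed.

Lemma mxfnorm_pythagoras m k n (U : 'M[R]_(m, k)) (A : 'M[R]_(m, n)) :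
  U^T *m U = 1%:M ->
  mxfnorm A ^+ 2 = mxfnorm (U^T *m A) ^+ 2
                   + mxfnorm ((1%:M - U *m U^T) *m A) ^+ 2.
Proof.
move=> UU; set PA := ((1%:M - _) *m A).
have cross : mxdot (U *m (U^T *m A)) PA = 0.
  rewrite mxdot_mull /PA mulmxA mulmxBr mulmx1 mulmxA UU mul1mx subrr.
  by rewrite mul0mx /mxdot mulmx0 linear0.
have {1}-> : A = U *m (U^T *m A) + PA.
  by rewrite /PA mulmxBl mul1mx mulmxA addrC subrK.
rewrite mxfnorm_sqr mxdotDl !mxdotDr (mxdotC PA) cross addr0 add0r.
by rewrite -!mxfnorm_sqr mxfnorm_isom.
Qed.

Lemma specnorm_orthoproj_le m k (U : 'M[R]_(m, k)) :
  U^T *m U = 1%:M -> specnorm (1%:M - U *m U^T) <= 1.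
Proof.
move=> UU; apply: specnorm_le => // x; rewrite mul1r.
rewrite -ler_sqr ?nnegrE ?mxfnorm_ge0 // (mxfnorm_pythagoras x UU).
by rewrite lerDr sqr_ge0.
Qed.

(** Write [A] as 1 A: the identity of size [m] has Frobenius norm sqrt m. *)
Lemma mxfnorm_le_specnorm m n (A : 'M[R]_(m, n)) :
  mxfnorm A <= Num.sqrt m%:R * specnorm A.
Proof.
have -> : Num.sqrt m%:R = mxfnorm (1%:M : 'M[R]_m).
  rewrite -[RHS]ger0_norm ?mxfnorm_ge0 // -sqrtr_sqr mxfnorm_sqr.
  by rewrite /mxdot mulmx1 trmx1 mxtrace1.
by rewrite -{1}(mul1mx A) specnormMr.
Qed.

End SpectralNorm.

(** * Perturbation of leading left singular subspaces *)

Section SingularSubspacePerturbation.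
Variable R : realType.
Implicit Types m n p k : nat.

(** Gram-Schmidt, one column at a time. A column already in the span is dropped, which is why [r]
    may fall below [k]. *)
Lemma orthonormal_range m k (V : 'M[R]_(m, k)) :
  exists r (L : 'M[R]_(m, r)),
    [/\ (r <= k)%N, L^T *m L = 1%:M & L *m L^T *m V = V].
Proof.
elim: k V => [|k IHk]; last rewrite -[k.+1]add1n; move=> V.
  by exists 0%N, 0; split=> //; [apply/matrixP => -[] | rewrite !thinmx0].
pose V' := rsubmx V.
have [r [L [rk LL LV]]] := IHk V'.
pose v := lsubmx V; pose w := v - L *m L^T *m v.
have VE : V = row_mx v V' by rewrite hsubmxK.
have [w0|w0] := eqVneq w 0.
  exists r, L; split => //; first exact: leq_trans rk (leq_addl _ _).
  rewrite VE mul_mx_row LV; congr row_mx.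
  by apply/esym/eqP; rewrite -subr_eq0 -/w w0.
have nw : 0 < mxfnorm w by rewrite lt_def mxfnorm_eq0 w0 mxfnorm_ge0.
pose u := (mxfnorm w)^-1 *: w.
have Lw : L^T *m w = 0 by rewrite mulmxBr !mulmxA LL mul1mx subrr.
have wL : w^T *m L = 0 by apply: trmx_inj; rewrite trmx_mul trmxK Lw linear0.
have ww : w^T *m w = (mxfnorm w ^+ 2)%:M.
  by rewrite [LHS]mx11_scalar -trace_mx11 mxfnorm_sqr.
have uv : u *m u^T *m v = w.
  have -> : v = w + L *m (L^T *m v) by rewrite mulmxA subrK.
  rewrite linearZ /= -scalemxAl -scalemxAr -scalemxAl -scalemxAl mulmxDr.
  rewrite -!mulmxA ww (mulmxA w^T) wL mul0mx mulmx0 addr0.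
  rewrite mul_mx_scalar !scalerA -[RHS]scale1r; congr (_ *: _).
  by field; rewrite gt_eqF.
have uT : u^T = (mxfnorm w)^-1 *: w^T by rewrite linearZ.
have Lu : L^T *m u = 0 by rewrite -scalemxAr Lw scaler0.
have uL : u^T *m L = 0 by rewrite uT -scalemxAl wL scaler0.
have uu : u^T *m u = 1%:M.
  rewrite uT -scalemxAl -scalemxAr ww !scale_scalar_mx; congr _%:M.
  by field; rewrite gt_eqF.
exists (r + 1)%N, (row_mx L u); split.
- by rewrite addn1 add1n.
- by rewrite tr_row_mx mul_col_row LL Lu uL uu -scalar_mx_block.
- rewrite tr_row_mx mul_row_col mulmxDl VE !mul_mx_row LV add_row_mx uv.
  congr row_mx; first by rewrite addrC subrK.
  (* [V'] is fixed by [L *m L^T] and [u] is orthogonal to [L], so the new direction contributes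
     nothing on [V']. *)
  by rewrite -[X in u *m u^T *m X]LV !mulmxA -(mulmxA u) uL mulmx0 !mul0mx addr0.
Qed.

(** Compressing by an orthonormal basis [L] of the column space of [M] keeps the Frobenius norm of
    [M], while [L^T *m W1] has at most [k] rows, even if [W1] has large rank. *)
Lemma low_rank_mxfnorm_le m n k (M W1 W2 : 'M[R]_(m, n)) :
  (\rank M <= k)%N -> M = W1 + W2 ->
  mxfnorm M <= Num.sqrt k%:R * specnorm W1 + mxfnorm W2.
Proof.
move=> rM ME; have [r [L [rk LL LM]]] := orthonormal_range (col_base M).
have {LM} LM : L *m L^T *m M = M by rewrite -{1}(mulmx_base M) mulmxA LM mulmx_base.
have -> : mxfnorm M = mxfnorm (L^T *m M) by rewrite -(mxfnorm_isom _ LL) mulmxA LM.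
have LT1 : specnorm L^T <= 1 by rewrite specnorm_tr specnorm_isom_le.
rewrite ME mulmxDr; apply: le_trans (mxfnormD _ _) _; apply: lerD; last first.
  apply: le_trans (specnormM _ _) _.
  by rewrite ler_piMl ?mxfnorm_ge0.
apply: le_trans (mxfnorm_le_specnorm _) _.
rewrite ler_pM ?sqrtr_ge0 ?specnorm_ge0 //.
  by rewrite ler_wsqrtr // ler_nat (leq_trans rk).
by apply: le_trans (specnorm_mul _ _) _; rewrite ler_piMl ?specnorm_ge0.
Qed.

(** A dimension count: restricted to the first [p] coordinates, [A] still has rank below [p], hence
    a nontrivial kernel. *)
Lemma ker_vector_supported m n p (A : 'M[R]_(m, n)) :
  (\rank A < p)%N -> (p <= n)%N ->
  exists x : 'cV[R]_n, [/\ mxdot x x = 1, A *m x = 0 &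
    forall j : 'I_n, (p <= j)%N -> x j 0 = 0].
Proof.
move=> rA pn; pose W : 'M[R]_(p, n) := pid_mx p.
have WW : W *m W^T = 1%:M by rewrite tr_pid_mx pid_mx_id // pid_mx_1.
have : kermx (W *m A^T) != 0.
  rewrite kermx_eq0 /row_free neq_ltn.
  by rewrite (leq_ltn_trans (mxrankM_maxr _ _)) // mxrank_tr.
move=> /rowV0Pn[z /sub_kermxP zWA z0].
pose y := z *m W; have y0 : y != 0.
  apply: contraNneq z0 => yE.
  by rewrite -(mulmx1 z) -WW mulmxA -/y yE mul0mx.
have ny : 0 < mxfnorm y by rewrite lt_def mxfnorm_eq0 y0 mxfnorm_ge0.
exists ((mxfnorm y)^-1 *: y^T); split.
- rewrite mxdotZl mxdotZr -mxfnorm_sqr mxfnorm_tr expr2.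
  by rewrite (mulrA _ (mxfnorm y)) mulVf ?mul1r ?mulVf ?gt_eqF.
- rewrite -scalemxAr -{1}(trmxK A) -trmx_mul -mulmxA zWA.
  by rewrite linear0 scaler0.
- move=> j pj; rewrite !mxE big1 ?mulr0 // => l _; rewrite !mxE.
  by rewrite ltn_eqF ?mulr0 // (leq_trans (ltn_ord l)).
Qed.

(** Orthogonality to the earlier vectors appends their rows to [A] and raises the rank by at most
    one each time, so every new vector needs one more coordinate. The staircase support matches the
    decreasing order of singular values. *)
Lemma ker_orthonormal_staircase m n k (A : 'M[R]_(m, n)) :
  (\rank A <= k)%N -> forall i, (i <= n - k)%N ->
  exists x : nat -> 'cV[R]_n,
    [/\ forall l, (l < i)%N -> A *m x l = 0,
        forall l, (l < i)%N -> forall j : 'I_n, (k + l < j)%N -> x l j 0 = 0 &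
        forall l l', (l < i)%N -> (l' < i)%N -> mxdot (x l) (x l') = (l == l')%:R].
Proof.
move=> rA; elim=> [|i IHi] hi; first by exists (fun=> 0).
have [x [xA xs xo]] := IHi (ltnW hi).
pose X := \matrix_(l < i) (x l)^T.
have rC : (\rank (col_mx A X) < (k + i).+1)%N.
  rewrite ltnS -addsmxE; apply: leq_trans (leq_of_leqif (mxrank_adds_leqif _ _)) _.
  by rewrite leq_add // rank_leq_row.
have [|z [zz /eqP zC zs]] := ker_vector_supported rC; first by lia.
move: zC; rewrite mul_col_mx col_mx_eq0 => /andP[/eqP zA /eqP zX].
have zx l : (l < i)%N -> mxdot (x l) z = 0.
  move=> li; have /matrixP/(_ (Ordinal li) 0) := zX.
  rewrite !mxE => <-; rewrite mxdotE; apply: eq_bigr => j _.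
  by rewrite big_ord1 !mxE.
exists (fun l => if (l < i)%N then x l else z); split.
- by move=> l _; case: ifP => // /xA.
- move=> l li j hj; case: ifP => [/xs-> // |li'].
  by rewrite zs //; lia.
- move=> l l' hl hl'; case: ifP => li; case: ifP => li'; first exact: xo.
  + by rewrite zx //; case: eqP => // ?; lia.
  + by rewrite mxdotC zx //; case: eqP => // ?; lia.
  + by rewrite zz; case: eqP => // ?; lia.
Qed.

Lemma mxfnorm_rdiag m n (D : 'M[R]_(m, n)) (x : 'cV_n) :
  (forall (i : 'I_m) (j : 'I_n), (i : nat) <> j -> D i j = 0) ->
  mxfnorm (D *m x) ^+ 2 = \sum_j (\sum_i D i j ^+ 2) * x j 0 ^+ 2.
Proof.
move=> D0; rewrite mxfnorm_row; under [RHS]eq_bigr do rewrite mulr_suml.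
rewrite exchange_big; apply: eq_bigr => i _ /=.
rewrite mxfnorm_sqr mxdotE !big_ord1 !mxE -expr2.
have [lin|nin] := ltnP i n; last first.
  have Di j : D i j = 0 by apply: D0 => ij; move: (ltn_ord j); rewrite -ij ltnNge nin.
  by rewrite !big1 ?expr0n // => j _; rewrite Di ?expr0n mul0r.
have Di j : j != Ordinal lin -> D i j = 0.
  by move=> /eqP ji; apply: D0 => ij; apply: ji; apply: val_inj.
rewrite (bigD1 (Ordinal lin)) //= [X in _ + X]big1 => [|j /Di ->]; last first.
  by rewrite mul0r.
rewrite [RHS](bigD1 (Ordinal lin)) //= [X in _ = _ + X]big1 => [|j /Di ->].
  by rewrite !addr0 exprMn.
by rewrite expr0n mul0r.
Qed.

Lemma specnorm_rdiag_le m n (D : 'M[R]_(m, n)) c : 0 <= c ->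
  (forall (i : 'I_m) (j : 'I_n), (i : nat) <> j -> D i j = 0) ->
  (forall i j, `|D i j| <= c) -> specnorm D <= c.
Proof.
move=> c0 D0 Dc; apply: specnorm_le => // x.
rewrite -ler_sqr ?nnegrE ?mulr_ge0 ?mxfnorm_ge0 // mxfnorm_rdiag // exprMn.
rewrite mxfnorm_row mulr_sumr; apply: ler_sum => j _.
rewrite mxfnorm_sqr mxdotE !big_ord1 !mxE -expr2 ler_wpM2r ?sqr_ge0 //.
have [lin|nin] := ltnP j m; last first.
  rewrite big1 ?sqr_ge0 // => i _; rewrite D0 ?expr0n // => ij.
  by move: (ltn_ord i); rewrite ij ltnNge nin.
rewrite (bigD1 (Ordinal lin)) //= big1 ?addr0 => [|i /eqP ij].
  by rewrite -real_normK ?num_real // ler_sqr ?nnegrE.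
by rewrite D0 ?expr0n // => ij'; apply: ij; apply: val_inj.
Qed.

Lemma leading_lsv_isom m n k (B : 'M[R]_(m, n)) (U : 'M[R]_(m, k)) :
  (k <= m)%N -> leading_lsv B U -> U^T *m U = 1%:M.
Proof.
move=> km [P [S [Q [[[PP _] _ _ _ _] ->]]]].
by rewrite trmx_mul mulmxA -(mulmxA _ P^T) PP mulmx1 tr_pid_mx pid_mx_id ?pid_mx_1.
Qed.

(** A Weyl-type bound. On the support of [x l], the coordinates up to [k + l], the diagonal of [S]
    is at least [S i j], so [S i j] is at most the norm of [S *m x l]. Up to isometries this is the
    norm of the noise alone, because [A] kills [Q *m x l]. *)
Lemma diag_entry_le_noise m n k (A Z1 Z2 : 'M[R]_(m, n)) P S Q
    (x : nat -> 'cV[R]_n) (i : 'I_m) (j : 'I_n) l :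
  is_svd (A + (Z1 + Z2)) P S Q -> A *m Q *m x l = 0 ->
  (forall j : 'I_n, (k + l < j)%N -> x l j 0 = 0) -> mxdot (x l) (x l) = 1 ->
  (i : nat) = j -> (j : nat) = (k + l)%N ->
  S i j <= specnorm Z1 + mxfnorm (Z2 *m (Q *m x l)).
Proof.
move=> [[PP QQ] BE Sd S0 Sm] Ax xs xx ij jl.
have nx : mxfnorm (x l) = 1.
  by rewrite -[LHS]ger0_norm ?mxfnorm_ge0 // -sqrtr_sqr mxfnorm_sqr xx sqrtr1.
have SBx : mxfnorm (S *m x l) = mxfnorm ((A + (Z1 + Z2)) *m (Q *m x l)).
  by rewrite BE -!mulmxA (mulmxA Q^T) QQ mul1mx (mxfnorm_isom _ PP).
have le1 : S i j <= mxfnorm (S *m x l).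
  rewrite -ler_sqr ?nnegrE ?mxfnorm_ge0 ?S0 // mxfnorm_rdiag //.
  rewrite -[leLHS]mulr1 -[1](expr1n _ 2) -nx mxfnorm_row mulr_sumr.
  apply: ler_sum => j' _.
  rewrite mxfnorm_sqr mxdotE !big_ord1 !mxE -expr2.
  have [jj'|jj'] := ltnP (k + l) j'; first by rewrite xs // expr0n !mulr0.
  (* Row [j'] exists because j' <= k + l = j = i < m. *)
  have im : (j' < m)%N by rewrite (leq_ltn_trans jj') // -jl -ij.
  rewrite ler_wpM2r ?sqr_ge0 // (bigD1 (Ordinal im)) //=.
  rewrite -[leLHS]addr0 lerD ?sumr_ge0 // => [|i' _]; last exact: sqr_ge0.
  by rewrite ler_sqr ?nnegrE ?S0 // Sm // ij jl.
apply: le_trans le1 _; rewrite SBx mulmxDl (mulmxA A) Ax add0r mulmxDl.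
apply: le_trans (mxfnormD _ _) _; rewrite lerD //.
by apply: le_trans (specnormM _ _) _; rewrite mxfnorm_isom // nx mulr1.
Qed.

(** The matrix has [k] zero columns followed by the orthonormal [x 0], [x 1], and so on; its Gram
    matrix is therefore diagonal with entries 0 and 1. *)
Lemma staircase_shift_specnorm n k (x : nat -> 'cV[R]_n) :
  (forall l l', (l < n - k)%N -> (l' < n - k)%N ->
     mxdot (x l) (x l') = (l == l')%:R) ->
  specnorm (\matrix_(a, j < n) (if (k <= j)%N then x (j - k)%N a 0 else 0)) <= 1.
Proof.
move=> xo; set X := \matrix_(a, j) _.
pose D : 'M[R]_n := \matrix_(i, j) ((i == j) && (k <= i)%N)%:R.
have XX : X^T *m X = D.
  apply/matrixP => i j; rewrite !mxE.
  under eq_bigr do rewrite !mxE.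
  have [ki|_] := boolP (k <= i)%N; last first.
    by rewrite andbF big1 // => a _; rewrite mul0r.
  have [kj|kj] := boolP (k <= j)%N; last first.
    rewrite big1 => [|a _]; last by rewrite mulr0.
    by case: eqP => // ij; rewrite -ij ki in kj.
  rewrite andbT; transitivity (mxdot (x (i - k)%N) (x (j - k)%N)).
    by rewrite mxdotE; apply: eq_bigr => a _; rewrite big_ord1.
  have hi : (i - k < n - k)%N by have := ltn_ord i; lia.
  have hj : (j - k < n - k)%N by have := ltn_ord j; lia.
  rewrite xo //; congr (_%:R); rewrite -val_eqE /=.
  by congr nat_of_bool; apply/eqP/eqP; lia.
have D1 : specnorm D <= 1.
  apply: specnorm_rdiag_le => // [i j ij|i j]; rewrite mxE.
    by case: eqP => // ij'; rewrite ij' in ij.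
  by rewrite ger0_norm ?ler0n // lern1 leq_b1.
apply: specnorm_le => // z; rewrite mul1r.
rewrite -ler_sqr ?nnegrE ?mxfnorm_ge0 // mxfnorm_sqr mxdot_mull mulmxA XX.
apply: le_trans (mxdot_le _ _) _; rewrite expr2 ler_wpM2l ?mxfnorm_ge0 //.
by apply: le_trans (specnormM _ _) _; rewrite ler_piMl ?mxfnorm_ge0.
Qed.

(* The singular values of [A + Z1 + Z2] beyond the [k]-th are the only ones
   left after the projection; the [(k + l + 1)]-st is at most
   [specnorm Z1 + mxfnorm (Z2 *m xi_l)] for suitable orthonormal vectors [xi_l]
   in the kernel of [A].  Truncating each of them at [specnorm Z1] gives the
   splitting. *)
Lemma leading_lsv_residual m n k (A Z1 Z2 : 'M[R]_(m, n)) (U : 'M[R]_(m, k)) :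
  (\rank A <= k)%N -> leading_lsv (A + (Z1 + Z2)) U ->
  exists Y1 Y2, [/\ (1%:M - U *m U^T) *m (A + (Z1 + Z2)) = Y1 + Y2,
    specnorm Y1 <= specnorm Z1 & mxfnorm Y2 <= mxfnorm Z2].
Proof.
move=> rA [P [S [Q [svd ->]]]].
have [x [xA xs xo]] : exists x : nat -> 'cV[R]_n,
    [/\ forall l, (l < n - k)%N -> A *m Q *m x l = 0,
        forall l, (l < n - k)%N -> forall j : 'I_n, (k + l < j)%N -> x l j 0 = 0 &
        forall l l', (l < n - k)%N -> (l' < n - k)%N ->
          mxdot (x l) (x l') = (l == l')%:R].
  by apply: ker_orthonormal_staircase; rewrite // (leq_trans (mxrankM_maxl _ _)).
have [[PP QQ] BE Sd S0 Sm] := svd.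
have PP' := mulmx1C PP.
pose S' : 'M[R]_(m, n) := \matrix_(i, j) (if (k <= i)%N then S i j else 0).
have SE : (1%:M - P *m pid_mx k *m (P *m pid_mx k : 'M_(m, k))^T)
    *m (A + (Z1 + Z2)) = P *m S' *m Q^T.
  have -> : P *m pid_mx k *m (P *m pid_mx k : 'M_(m, k))^T = P *m pid_mx k *m P^T.
    rewrite trmx_mul tr_pid_mx mulmxA -(mulmxA P) mul_pid_mx !minnn.
    by [].
  rewrite BE mulmxBl mul1mx -!mulmxA (mulmxA P^T) PP mul1mx -mulmxBr mulmxA.
  rewrite -mulmxA; congr (_ *m _); rewrite mulmxA -mulmxBl; congr (_ *m _).
  apply/matrixP => i j; rewrite !mxE.
  rewrite (bigD1 i) //= big1 => [|a /negPf ai].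
    rewrite !mxE !eqxx /= addr0; case: (ltnP i k) => _.
      by rewrite mul1r subrr.
    by rewrite mul0r subr0.
  by rewrite !mxE val_eqE eq_sym ai mul0r.
pose t := specnorm Z1; have t0 : 0 <= t := specnorm_ge0 _.
have S'd (i : 'I_m) (j : 'I_n) : (i : nat) <> j -> S' i j = 0.
  by move=> ij; rewrite mxE Sd // if_same.
have S'0 i j : 0 <= S' i j.
  rewrite mxE; case: ifP => // _; case: (eqVneq (i : nat) j) => [/S0 //|/eqP ij].
  by rewrite Sd.
pose D1 := \matrix_(i, j) Num.min (S' i j) t; pose D2 := S' - D1.
have D1le : specnorm D1 <= t.
  apply: specnorm_rdiag_le => // [i j ij|i j]; rewrite mxE.
    by rewrite S'd // min_l.
  by rewrite ger0_norm ?le_min ?S'0 // ge_min lexx orbT.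
(* Padding with [k] zero columns lines up column [j] with the singular value at position [j], so
   [D2] and [Z2 *m (Q *m X)] can be compared column by column. *)
pose X : 'M[R]_n := \matrix_(a, j) (if (k <= j)%N then x (j - k)%N a 0 else 0).
have X1 : specnorm X <= 1 by exact: staircase_shift_specnorm.
have D2le : mxfnorm D2 <= mxfnorm (Z2 *m (Q *m X)).
  rewrite -ler_sqr ?nnegrE ?mxfnorm_ge0 // !mxfnorm_col.
  apply: ler_sum => j _.
  have D2d (i : 'I_m) : (i : nat) <> j -> D2 i j = 0.
    by move=> ij; rewrite !mxE Sd // if_same min_l ?subrr.
  rewrite [leLHS]mxfnorm_sqr mxdotE; under eq_bigr do rewrite big_ord1 !mxE -expr2.
  have [jm|mj] := ltnP j m; last first.
    rewrite big1 ?sqr_ge0 // => i _; have := D2d i; rewrite !mxE => -> //.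
      by rewrite expr0n.
    by move=> ij; move: (ltn_ord i); rewrite ij ltnNge mj.
  rewrite (bigD1 (Ordinal jm)) //= big1 ?addr0 => [|i /eqP ij]; last first.
    have := D2d i; rewrite !mxE => -> //; first by rewrite expr0n.
    by move=> ij'; apply: ij; apply: val_inj.
  (* Column [j] of [D2] vanishes for j < k. From [k] on, its only possibly nonzero entry is the
     positive part of the singular value minus [t]. *)
  case: (leqP k j) => [kj|_]; last by rewrite min_l // subrr expr0n sqr_ge0.
  have jk : (j - k < n - k)%N by have := ltn_ord j; lia.
  have -> : col j (Z2 *m (Q *m X)) = Z2 *m (Q *m x (j - k)%N).
    rewrite !colE -!mulmxA; congr (_ *m (_ *m _)); rewrite -colE.
    by apply/matrixP => a b; rewrite !mxE kj (ord1 b).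
  have Sle : S (Ordinal jm) j <= t + mxfnorm (Z2 *m (Q *m x (j - k)%N)).
    apply: (diag_entry_le_noise svd (xA _ jk) (xs _ jk)) => //.
      by rewrite xo // eqxx.
    by rewrite subnKC.
  rewrite ler_sqr ?nnegrE ?mxfnorm_ge0 ?subr_ge0 ?ge_min ?lexx //.
  rewrite lerBlDl; case: (leP (S (Ordinal jm) j) t) => // _.
  by rewrite lerDl mxfnorm_ge0.
exists (P *m D1 *m Q^T), (P *m D2 *m Q^T); split.
- by rewrite SE -mulmxDl -mulmxDr addrC subrK.
- apply: le_trans (specnorm_mul _ _) _; rewrite specnorm_tr.
  apply: le_trans (ler_piMr (specnorm_ge0 _) (specnorm_isom_le QQ)) _.
  apply: le_trans (specnorm_mul _ _) _.
  apply: le_trans (ler_piMl (specnorm_ge0 _) (specnorm_isom_le PP)) _.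
  exact: D1le.
- rewrite -mulmxA mxfnorm_isom // -mxfnorm_tr trmx_mul trmxK mxfnorm_isom //.
  rewrite mxfnorm_tr; apply: le_trans D2le _.
  apply: le_trans (specnormMr _ _) _; rewrite ler_piMr ?mxfnorm_ge0 //.
  apply: le_trans (specnorm_mul _ _) _.
  by apply: mulr_ile1; rewrite ?specnorm_ge0 //; apply: specnorm_isom_le.
Qed.

(** The residual of [A] is that of A + Z1 + Z2 minus the projected noise. Each of the two terms
    costs the noise once, whence the factor 2. *)
Lemma leading_lsv_perturbation m n k (A Z1 Z2 : 'M[R]_(m, n)) (U : 'M[R]_(m, k)) :
  (k <= m)%N -> (\rank A <= k)%N -> leading_lsv (A + (Z1 + Z2)) U ->
  exists W1 W2, [/\ (1%:M - U *m U^T) *m A = W1 + W2,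
    specnorm W1 <= 2 * specnorm Z1 & mxfnorm W2 <= 2 * mxfnorm Z2].
Proof.
move=> km rA lsv; have [Y1 [Y2 [YE Y1le Y2le]]] := leading_lsv_residual rA lsv.
have PU := specnorm_orthoproj_le (leading_lsv_isom km lsv).
set PU' := 1%:M - _ in YE PU *.
exists (Y1 - PU' *m Z1), (Y2 - PU' *m Z2); split.
- by rewrite addrACA -opprD -YE -mulmxDr -mulmxBr addrK.
- apply: le_trans (specnormB _ _) _; rewrite mulr_natl mulr2n lerD //.
  by apply: le_trans (specnorm_mul _ _) _; rewrite ler_piMl ?specnorm_ge0.
- apply: le_trans (mxfnormB _ _) _; rewrite mulr_natl mulr2n lerD //.
  by apply: le_trans (specnormM _ _) _; rewrite ler_piMl ?mxfnorm_ge0.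
Qed.

End SingularSubspacePerturbation.

(** * Nearly aligned orthonormal frames *)

Section SubspaceAlignment.
Variable R : realType.
Implicit Types m n p k : nat.

Lemma mxfnorm_le_mul m n p (G : 'M[R]_(m, n)) (B : 'M[R]_(n, p)) c : 0 <= c ->
  (forall z : 'cV_n, mxfnorm z <= c * mxfnorm (G *m z)) ->
  mxfnorm B <= c * mxfnorm (G *m B).
Proof.
move=> c0 Gc; rewrite -ler_sqr ?nnegrE ?mulr_ge0 ?mxfnorm_ge0 // exprMn.
rewrite !mxfnorm_col mulr_sumr; apply: ler_sum => j _.
have -> : col j (G *m B) = G *m col j B by rewrite !colE mulmxA.
by rewrite -exprMn ler_sqr ?nnegrE ?mulr_ge0 ?mxfnorm_ge0.
Qed.

(* A sine of at most 1/11 keeps all cosines above 100/101. *)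
Lemma small_angle_cos m k (V Vs : 'M[R]_(m, k)) :
  V^T *m V = 1%:M -> Vs^T *m Vs = 1%:M ->
  specnorm ((1%:M - V *m V^T) *m Vs) <= 1 / 11 ->
  forall z : 'cV_k, mxfnorm z <= 101 / 100 * mxfnorm (V^T *m Vs *m z).
Proof.
move=> VV VsVs x11 z.
have := mxfnorm_pythagoras (Vs *m z) VV.
rewrite mxfnorm_isom // !mulmxA => pyth.
have := specnormM ((1%:M - V *m V^T) *m Vs) z.
have := specnorm_ge0 ((1%:M - V *m V^T) *m Vs).
move: x11 pyth (mxfnorm_ge0 z) (mxfnorm_ge0 (V^T *m Vs *m z)).
move: (mxfnorm_ge0 ((1%:M - V *m V^T) *m Vs *m z)).
move: (mxfnorm (V^T *m Vs *m z)) (mxfnorm z) => b a.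
move: (specnorm _) (mxfnorm _).
move=> x d d0 x11 pyth a0 b0 x0 dx.
(* Here d <= a / 11 and a^2 = b^2 + d^2, so b^2 is at least (120/121) a^2, which is at least
   (100/101)^2 a^2. *)
have da : 11 * d <= a by nra.
have dda : 0 <= (a - 11 * d) * (a + 11 * d) by rewrite mulr_ge0 //; lra.
have bb : 0 <= b ^+ 2 := sqr_ge0 b.
by rewrite -ler_sqr ?nnegrE //; lra.
Qed.

(** With G = V^T Vs, one has V = P_V Vs G^-1 = Vs G^-1 - (1 - P_V) Vs G^-1; the transpose is the
    splitting. The lower bound on the cosines makes [G] invertible with ||G^-1|| <= 101/100. *)
Lemma small_angle_split m k (V Vs : 'M[R]_(m, k)) x :
  V^T *m V = 1%:M -> Vs^T *m Vs = 1%:M ->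
  specnorm ((1%:M - V *m V^T) *m Vs) <= x -> x <= 1 / 11 ->
  exists C D, [/\ V^T = C *m Vs^T + D, specnorm C <= 101 / 100 &
    specnorm D <= 101 / 100 * x].
Proof.
move=> VV VsVs hx x11; have cosG := small_angle_cos VV VsVs (le_trans hx x11).
pose G := V^T *m Vs.
have Gu : G \in unitmx.
  rewrite -unitmx_tr -row_free_unit -kermx_eq0; apply/rowV0P => y /sub_kermxP yG.
  apply: trmx_inj; apply/eqP; rewrite trmx0 -mxfnorm_eq0 eq_le mxfnorm_ge0 andbT.
  apply: le_trans (cosG _) _; rewrite -/G.
  by rewrite -(trmxK G) -trmx_mul yG trmx0 mxfnorm0 mulr0.
have HV : specnorm (invmx G) <= 101 / 100.
  apply: specnorm_le => [|z]; first by lra.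
  by apply: le_trans (cosG _) _; rewrite mulmxA mulmxV // mul1mx.
exists (invmx G)^T, (- ((1%:M - V *m V^T) *m Vs *m invmx G)^T); split.
- rewrite -trmx_mul -linearB /=; congr _^T.
  rewrite -mulmxA mulmxBl mul1mx opprB addrC subrK -!mulmxA.
  by rewrite (mulmxA V^T) mulmxV // mulmx1.
- by rewrite specnorm_tr.
- rewrite specnormN specnorm_tr; apply: le_trans (specnorm_mul _ _) _.
  by rewrite mulrC ler_pM ?specnorm_ge0.
Qed.

End SubspaceAlignment.

(** * Lower bounds by the k-th singular value *)

Section SingularValues.
Variable R : realType.
Implicit Types m n k : nat.

(** Positivity excludes the out-of-range default 0 of [diag_entry]. *)
Lemma diag_entry_gt0 m n (S : 'M[R]_(m, n)) k : 0 < diag_entry S k ->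
  exists (i : 'I_m) (j : 'I_n),
    [/\ (i : nat) = k, (j : nat) = k & diag_entry S k = S i j].
Proof.
move=> s0; have [km|mk] := ltnP k m; last first.
  move: s0; rewrite /diag_entry big1 ?ltxx // => i _; rewrite big1 // => j _.
  by case: eqP => //= ik; move: (ltn_ord i); rewrite ik ltnNge mk.
have [kn|nk] := ltnP k n; last first.
  move: s0; rewrite /diag_entry big1 ?ltxx // => i _; rewrite big1 // => j _.
  by case: (eqVneq (j : nat) k) => [jk|]; rewrite ?andbF //;
    move: (ltn_ord j); rewrite jk ltnNge nk.
exists (Ordinal km), (Ordinal kn); split => //.
rewrite /diag_entry (bigD1 (Ordinal km)) //= [X in _ + X]big1 ?addr0.
  rewrite (bigD1 (Ordinal kn)) //= [X in _ + X]big1 ?addr0 ?eqxx // => j jk.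
  by rewrite -[(j : nat) == k]/(j == Ordinal kn) (negPf jk) andbF.
move=> i ik; rewrite big1 // => j _.
by rewrite -[(i : nat) == k]/(i == Ordinal km) (negPf ik).
Qed.

(** If the k-th singular value is positive, the first [k] left singular vectors span the range of
    [Us], so they equal [Us *m c] with [c] orthogonal. In these coordinates [B] is a diagonal with
    entries at least that value, followed by isometries. *)
Lemma svd_diag_entry_le m n k (Us : 'M[R]_(m, k)) (B : 'M[R]_(k, n)) P S Q
    (y : 'rV_k) :
  (0 < k)%N -> Us^T *m Us = 1%:M -> is_svd (Us *m B) P S Q ->
  diag_entry S k.-1 * mxfnorm y <= mxfnorm (y *m B).
Proof.
move=> k0 UU [[PP QQ] BE Sd S0 Sm].
have [s0|s0] := leP (diag_entry S k.-1) 0.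
  by rewrite (le_trans _ (mxfnorm_ge0 _)) // mulr_le0_ge0 ?mxfnorm_ge0.
have [i0 [j0 [i0k j0k sE]]] := diag_entry_gt0 s0; set s := diag_entry _ _ in s0 sE *.
have km : (k <= m)%N by rewrite -(prednK k0) -i0k.
have kn : (k <= n)%N by rewrite -(prednK k0) -j0k.
(* The leading singular values, all at least [s] by their ordering; being positive, they have the
   inverses collected in [e]. *)
pose d : 'rV[R]_k := \row_i S (widen_ord km i) (widen_ord kn i).
have ds i : s <= d 0 i.
  by rewrite mxE sE Sm //= i0k; have := ltn_ord i; lia.
pose Tk : 'M[R]_(m, k) := pid_mx k; pose Rk : 'M[R]_(n, k) := pid_mx k.
have TT : Tk^T *m Tk = 1%:M by rewrite tr_pid_mx pid_mx_id // pid_mx_1.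
have RR : Rk^T *m Rk = 1%:M by rewrite tr_pid_mx pid_mx_id // pid_mx_1.
have SR : S *m Rk = Tk *m diag_mx d.
  apply/matrixP => i j; rewrite mul_mx_diag !mxE.
  rewrite (bigD1 (widen_ord kn j)) //= big1 ?addr0 => [|l lj]; last first.
    rewrite mxE; case: eqP => [lj'|_]; last by rewrite mulr0.
    by case/eqP: lj; apply: val_inj.
  rewrite mxE /= eqxx ltn_ord mulr1; case: (eqVneq (i : nat) j) => [ij|ij].
    rewrite ij ltn_ord /= mul1r; congr (S _ _); exact: val_inj.
  by rewrite mul0r Sd //; apply/eqP.
have TS : Tk^T *m S = diag_mx d *m Rk^T.
  apply/matrixP => i j; rewrite mul_diag_mx !mxE.
  rewrite (bigD1 (widen_ord km i)) //= big1 ?addr0 => [|l li]; last first.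
    rewrite !mxE; case: eqP => [li'|_]; last by rewrite mul0r.
    by case/eqP: li; apply: val_inj.
  rewrite !mxE /= eqxx ltn_ord mul1r; case: (eqVneq (j : nat) i) => [ij|ij].
    rewrite ij ltn_ord /= mulr1; congr (S _ _); exact: val_inj.
  by rewrite mulr0 Sd // => /= ij'; rewrite -ij' eqxx in ij.
pose e : 'rV[R]_k := \row_i (d 0 i)^-1.
have de : diag_mx d *m diag_mx e = 1%:M.
  rewrite mulmx_diag -diag_const_mx; congr diag_mx; apply/rowP => i.
  have : d 0 i != 0 by rewrite gt_eqF // (lt_le_trans s0).
  by rewrite !mxE; apply: divff.
(* Apply [Us *m B] to the leading right singular vectors and divide by the singular values: the
   result is both [P *m Tk] and [Us *m c]. *)
pose c := B *m Q *m Rk *m diag_mx e.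
have Pc : P *m Tk = Us *m c.
  rewrite /c !mulmxA BE -(mulmxA _ Q^T) QQ mulmx1 -(mulmxA P) SR -!mulmxA.
  by rewrite de mulmx1.
have cc : c^T *m c = 1%:M.
  have : (P *m Tk)^T *m (P *m Tk) = 1%:M.
    by rewrite trmx_mul mulmxA -(mulmxA _ P^T) PP mulmx1.
  by rewrite Pc trmx_mul mulmxA -(mulmxA c^T) UU mulmx1.
have cc' := mulmx1C cc.
have cB : c^T *m B = diag_mx d *m Rk^T *m Q^T.
  rewrite -(mul1mx B) -UU -(mulmxA Us^T) mulmxA -(trmx_mul Us c) -Pc BE trmx_mul.
  by rewrite -!mulmxA (mulmxA P^T) PP mul1mx !mulmxA TS.
have yB : y *m B = y *m c *m diag_mx d *m Rk^T *m Q^T.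
  by rewrite -{1}(mulmx1 y) -cc' -!mulmxA cB !mulmxA.
have -> : mxfnorm y = mxfnorm (y *m c).
  rewrite -[LHS]mxfnorm_tr -[RHS]mxfnorm_tr trmx_mul mxfnorm_isom //.
  by rewrite trmxK.
rewrite yB -[leRHS]mxfnorm_tr trmx_mul trmxK (mxfnorm_isom _ QQ).
rewrite trmx_mul trmxK (mxfnorm_isom _ RR) mxfnorm_tr.
rewrite -ler_sqr ?nnegrE ?mulr_ge0 ?mxfnorm_ge0 ?(ltW s0) //.
rewrite exprMn !mxfnorm_sqr !mxdotE !big_ord1 mulr_sumr mul_mx_diag.
apply: ler_sum => j _; rewrite [in leRHS]mxE -!expr2 exprMn mulrC.
by rewrite ler_wpM2l ?sqr_ge0 // lerXn2r ?nnegrE ?(ltW s0) // ltW // (lt_le_trans s0).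
Qed.

(* Holds without any existence of SVDs: [sup] of the empty set is 0. *)
Lemma sing_val_le m n k (Us : 'M[R]_(m, k)) (B : 'M[R]_(k, n)) (y : 'rV_k) :
  (0 < k)%N -> Us^T *m Us = 1%:M ->
  sing_val (Us *m B) k * mxfnorm y <= mxfnorm (y *m B).
Proof.
move=> k0 UU; have [->|y0] := eqVneq y 0; first by rewrite mul0mx !mxfnorm0 mulr0.
have ny : 0 < mxfnorm y by rewrite lt_def mxfnorm_eq0 y0 mxfnorm_ge0.
rewrite -ler_pdivlMr // /sing_val.
set A := [set _ | _]; have [->|/set0P A0] := eqVneq A set0.
  by rewrite sup0 divr_ge0 ?mxfnorm_ge0.
apply: ge_sup => // _ [P [S [Q [svd ->]]]]; rewrite ler_pdivlMr //.
exact: svd_diag_entry_le svd.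
Qed.

(** Turns a residual bound into a bound on a sine: by [sing_val_le], multiplying the row
    [y *m P *m Us] by [B] enlarges its norm by at least the singular value. *)
Lemma sing_val_specnorm m n k p (Us : 'M[R]_(m, k)) (B : 'M[R]_(k, n))
    (P : 'M[R]_(p, m)) :
  (0 < k)%N -> Us^T *m Us = 1%:M -> 0 <= sing_val (Us *m B) k ->
  specnorm (P *m Us) * sing_val (Us *m B) k <= specnorm (P *m (Us *m B)).
Proof.
move=> k0 UU; rewrite le0r => /orP[/eqP->|s0]; first by rewrite mulr0 specnorm_ge0.
rewrite -ler_pdivlMr //; apply: specnorm_le_rV => [|y].
  by rewrite divr_ge0 ?specnorm_ge0 ?ltW.
rewrite mulrAC ler_pdivlMr // mulrC.
apply: le_trans (sing_val_le _ _ k0 UU) _.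
by rewrite -!mulmxA mulrC specnormMr.
Qed.

End SingularValues.

(** * Unfoldings, mode products and norms of tensors *)

Section TensorNorms.
Variable R : realType.

Lemma mulmx_unfold1 m n1 n2 n3 (M : 'M[R]_(m, n1)) (X : tensor R n1 n2 n3) :
  M *m unfold1 X = unfold1 (mode1 M X).
Proof. by apply/matrixP => a j; rewrite !mxE; apply: eq_bigr => i _; rewrite mxE. Qed.

Lemma mulmx_unfold3 m n1 n2 n3 (M : 'M[R]_(m, n3)) (X : tensor R n1 n2 n3) :
  M *m unfold3 X = unfold3 (mode3 M X).
Proof. by apply/matrixP => a j; rewrite !mxE; apply: eq_bigr => i _; rewrite mxE. Qed.

Lemma unfold1_inj n1 n2 n3 : injective (@unfold1 R n1 n2 n3).
Proof.
move=> X Y /matrixP XY; apply/funext => a; apply/funext => b; apply/funext => c.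
by have := XY a (mxtens_index (b, c)); rewrite !mxE mxtens_indexK.
Qed.

Lemma unfold3_inj n1 n2 n3 : injective (@unfold3 R n1 n2 n3).
Proof.
move=> X Y /matrixP XY; apply/funext => a; apply/funext => b; apply/funext => c.
by have := XY c (mxtens_index (a, b)); rewrite !mxE mxtens_indexK.
Qed.

Lemma sum_mxtens (n p : nat) (F : 'I_n -> 'I_p -> R) :
  \sum_(j < n * p) F (mxtens_unindex j).1 (mxtens_unindex j).2
  = \sum_a \sum_b F a b.
Proof.
rewrite pair_big (reindex (@mxtens_index n p)); last first.
  by exists (@mxtens_unindex n p) => x _; [apply: mxtens_indexK | apply: mxtens_unindexK].
by apply: eq_bigr => -[a b] _; rewrite mxtens_indexK.
Qed.

Lemma mxfnorm_unfold1 n1 n2 n3 (X : tensor R n1 n2 n3) :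
  mxfnorm (unfold1 X) = tfnorm X.
Proof.
congr Num.sqrt; apply: eq_bigr => a _; rewrite -sum_mxtens.
by apply: eq_bigr => j _; rewrite mxE.
Qed.

Lemma mxfnorm_unfold3 n1 n2 n3 (X : tensor R n1 n2 n3) :
  mxfnorm (unfold3 X) = tfnorm X.
Proof.
congr Num.sqrt; under [RHS]eq_bigr do rewrite exchange_big.
rewrite [RHS]exchange_big; apply: eq_bigr => c _; rewrite -sum_mxtens.
by apply: eq_bigr => j _; rewrite mxE.
Qed.

Lemma mode1_mode3 m p n1 n2 n3 (A : 'M[R]_(m, n1)) (B : 'M[R]_(p, n3))
    (X : tensor R n1 n2 n3) : mode1 A (mode3 B X) = mode3 B (mode1 A X).
Proof.
apply/funext => a; apply/funext => b; apply/funext => c; rewrite /mode1 /mode3.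
under eq_bigr do rewrite mulr_sumr; rewrite exchange_big.
apply: eq_bigr => j _; rewrite mulr_sumr; apply: eq_bigr => i _.
by rewrite mulrCA.
Qed.

Lemma mode1M m p n1 n2 n3 (A : 'M[R]_(m, p)) (B : 'M[R]_(p, n1))
    (X : tensor R n1 n2 n3) : mode1 A (mode1 B X) = mode1 (A *m B) X.
Proof. by apply: unfold1_inj; rewrite -!mulmx_unfold1 mulmxA. Qed.

Lemma mode3M m p n1 n2 n3 (A : 'M[R]_(m, p)) (B : 'M[R]_(p, n3))
    (X : tensor R n1 n2 n3) : mode3 A (mode3 B X) = mode3 (A *m B) X.
Proof. by apply: unfold3_inj; rewrite -!mulmx_unfold3 mulmxA. Qed.

Lemma unfold1D n1 n2 n3 (X Y : tensor R n1 n2 n3) :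
  unfold1 (tadd X Y) = unfold1 X + unfold1 Y.
Proof. by apply/matrixP => a j; rewrite !mxE. Qed.

Lemma unfold3D n1 n2 n3 (X Y : tensor R n1 n2 n3) :
  unfold3 (tadd X Y) = unfold3 X + unfold3 Y.
Proof. by apply/matrixP => a j; rewrite !mxE. Qed.

Lemma unfold1B n1 n2 n3 (X Y : tensor R n1 n2 n3) :
  unfold1 (tsub X Y) = unfold1 X - unfold1 Y.
Proof. by apply/matrixP => a j; rewrite !mxE. Qed.

Lemma mode1D m n1 n2 n3 (M : 'M[R]_(m, n1)) (X Y : tensor R n1 n2 n3) :
  mode1 M (tadd X Y) = tadd (mode1 M X) (mode1 M Y).
Proof. by apply: unfold1_inj; rewrite unfold1D -!mulmx_unfold1 unfold1D mulmxDr. Qed.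

Lemma mode3D m n1 n2 n3 (M : 'M[R]_(m, n3)) (X Y : tensor R n1 n2 n3) :
  mode3 M (tadd X Y) = tadd (mode3 M X) (mode3 M Y).
Proof. by apply: unfold3_inj; rewrite unfold3D -!mulmx_unfold3 unfold3D mulmxDr. Qed.

Lemma mode1Dl m n1 n2 n3 (A B : 'M[R]_(m, n1)) (X : tensor R n1 n2 n3) :
  mode1 (A + B) X = tadd (mode1 A X) (mode1 B X).
Proof. by apply: unfold1_inj; rewrite unfold1D -!mulmx_unfold1 mulmxDl. Qed.

Lemma mode3Dl m n1 n2 n3 (A B : 'M[R]_(m, n3)) (X : tensor R n1 n2 n3) :
  mode3 (A + B) X = tadd (mode3 A X) (mode3 B X).
Proof. by apply: unfold3_inj; rewrite unfold3D -!mulmx_unfold3 mulmxDl. Qed.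

Lemma mode3_1 n1 n2 n3 (X : tensor R n1 n2 n3) : mode3 1%:M X = X.
Proof. by apply: unfold3_inj; rewrite -mulmx_unfold3 mul1mx. Qed.

Lemma tfnorm_mode1_le m n1 n2 n3 (M : 'M[R]_(m, n1)) (X : tensor R n1 n2 n3) :
  tfnorm (mode1 M X) <= specnorm M * tfnorm X.
Proof. by rewrite -!mxfnorm_unfold1 -mulmx_unfold1 specnormM. Qed.

Lemma tfnorm_mode3_le m n1 n2 n3 (M : 'M[R]_(m, n3)) (X : tensor R n1 n2 n3) :
  tfnorm (mode3 M X) <= specnorm M * tfnorm X.
Proof. by rewrite -!mxfnorm_unfold3 -mulmx_unfold3 specnormM. Qed.

Lemma tfnorm_mode1_isom m n1 n2 n3 (U : 'M[R]_(m, n1)) (X : tensor R n1 n2 n3) :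
  U^T *m U = 1%:M -> tfnorm (mode1 U X) = tfnorm X.
Proof. by move=> UU; rewrite -!mxfnorm_unfold1 -mulmx_unfold1 mxfnorm_isom. Qed.

Lemma tfnorm_mode3_isom m n1 n2 n3 (V : 'M[R]_(m, n3)) (X : tensor R n1 n2 n3) :
  V^T *m V = 1%:M -> tfnorm (mode3 V X) = tfnorm X.
Proof. by move=> VV; rewrite -!mxfnorm_unfold3 -mulmx_unfold3 mxfnorm_isom. Qed.

(** Testing the unfolding against row vectors turns its spectral norm into Frobenius norms of mode-1
    products. These commute with mode-3 products, so Frobenius comparisons in mode 3 pass to
    spectral norms of the mode-1 unfolding. *)
Lemma specnorm_unfold1_le m n1 n2 n3 p (X : tensor R n1 n2 n3)
    (Y : tensor R n1 m p) c : 0 <= c ->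
  (forall y : 'rV[R]_n1, tfnorm (mode1 y X) <= c * tfnorm (mode1 y Y)) ->
  specnorm (unfold1 X) <= c * specnorm (unfold1 Y).
Proof.
move=> c0 XY; apply: specnorm_le_rV => [|y]; first by rewrite mulr_ge0 ?specnorm_ge0.
rewrite mulmx_unfold1 mxfnorm_unfold1; apply: le_trans (XY y) _.
rewrite -mxfnorm_unfold1 -mulmx_unfold1 -mulrA ler_wpM2l // mulrC.
exact: specnormMr.
Qed.

Lemma specnorm_unfold3_le m n1 n2 n3 p (X : tensor R n1 n2 n3)
    (Y : tensor R m p n3) c : 0 <= c ->
  (forall y : 'rV[R]_n3, tfnorm (mode3 y X) <= c * tfnorm (mode3 y Y)) ->
  specnorm (unfold3 X) <= c * specnorm (unfold3 Y).
Proof.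
move=> c0 XY; apply: specnorm_le_rV => [|y]; first by rewrite mulr_ge0 ?specnorm_ge0.
rewrite mulmx_unfold3 mxfnorm_unfold3; apply: le_trans (XY y) _.
rewrite -mxfnorm_unfold3 -mulmx_unfold3 -mulrA ler_wpM2l // mulrC.
exact: specnormMr.
Qed.

Lemma specnorm_unfold1_mode3 m n1 n2 n3 (M : 'M[R]_(m, n3))
    (X : tensor R n1 n2 n3) :
  specnorm (unfold1 (mode3 M X)) <= specnorm M * specnorm (unfold1 X).
Proof.
apply: specnorm_unfold1_le => [|y]; first exact: specnorm_ge0.
by rewrite mode1_mode3 tfnorm_mode3_le.
Qed.

Lemma specnorm_unfold3_mode1 m n1 n2 n3 (M : 'M[R]_(m, n1))
    (X : tensor R n1 n2 n3) :
  specnorm (unfold3 (mode1 M X)) <= specnorm M * specnorm (unfold3 X).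
Proof.
apply: specnorm_unfold3_le => [|y]; first exact: specnorm_ge0.
by rewrite -mode1_mode3 tfnorm_mode1_le.
Qed.

(** Identifies the Kronecker form in the hypothesis on sigma_K with the mode product that defines
    betaV. *)
Lemma unfold3_tens m n1 n2 n3 (U : 'M[R]_(n1, m)) (X : tensor R n1 n2 n3) :
  unfold3 X *m (U *t (1%:M : 'M_n2)) = unfold3 (mode1 U^T X).
Proof.
apply/matrixP => c j; rewrite !mxE.
case: (mxtens_indexP j) => {j} a b; rewrite mxtens_indexK /=.
pose F a' b' : R := X a' b' c * (U a' a * (b' == b)%:R).
transitivity (\sum_(i < n1 * n2) F (mxtens_unindex i).1 (mxtens_unindex i).2).
  apply: eq_bigr => i _; case: (mxtens_indexP i) => {i} a' b'.
  by rewrite tensmxE !mxE mxtens_indexK.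
rewrite sum_mxtens; apply: eq_bigr => a' _.
rewrite (bigD1 b) //= big1 => [|b' /negPf bb'].
  by rewrite /F eqxx mulr1 addr0 mxE mulrC.
by rewrite /F bb' !mulr0.
Qed.

End TensorNorms.

(** * One half-step of the iteration *)

Section PowerIterationStep.
Variable R : realType.
Implicit Types m n p q k : nat.

Lemma leading_lsv_specnorm m n k (A Z : 'M[R]_(m, n)) (U : 'M[R]_(m, k)) :
  (k <= m)%N -> (\rank A <= k)%N -> leading_lsv (A + Z) U ->
  specnorm ((1%:M - U *m U^T) *m A) <= 2 * specnorm Z.
Proof.
move=> km rA; rewrite -[Z]addr0 => /(leading_lsv_perturbation km rA).
move=> [W1 [W2 [-> W1le]]]; rewrite mxfnorm0 mulr0 addr0 => W2le.
have -> : W2 = 0 by apply/eqP; rewrite -mxfnorm_eq0 eq_le W2le mxfnorm_ge0.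
by rewrite addr0.
Qed.

(** Homogeneity rescales [D] to norm at most one. The bound by [c] makes the set under [sup] bounded
    and settles the case of norm zero, where no rescaling is possible. *)
Lemma specnorm_le_sup p q (f : 'M[R]_(p, q) -> R) c :
  (forall D, 0 <= f D) -> 0 <= c ->
  (forall a D, f (a *: D) <= `|a| * f D) -> (forall D, f D <= specnorm D * c) ->
  forall D, f D <= specnorm D * sup [set f V^T | V in [set V | specnorm V <= 1]].
Proof.
move=> f0 c0 fZ fc D; have [D0|D0] := leP (specnorm D) 0.
  have -> : specnorm D = 0 by apply/eqP; rewrite eq_le D0 specnorm_ge0.
  by rewrite mul0r (le_trans (fc D)) // mulr_le0_ge0.
pose s := specnorm D.
have {1}-> : D = s *: (s^-1 *: D) by rewrite scalerA divff ?scale1r ?gt_eqF.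
apply: le_trans (fZ _ _) _; rewrite gtr0_norm // ler_wpM2l ?(ltW D0) //.
apply: ub_le_sup.
  exists c => _ [V /= V1 <-]; apply: le_trans (fc _) _.
  by rewrite specnorm_tr ler_piMl.
exists (s^-1 *: D)^T; rewrite /= ?trmxK // specnorm_tr.
apply: le_trans (specnormZ_le _ _) _.
by rewrite gtr0_norm ?invr_gt0 // mulVf ?gt_eqF.
Qed.

Variables (d1 d2 d3 J K : nat) (Us : 'M[R]_(d1, J)) (Vs : 'M[R]_(d3, K)).
Variables (Ts E : tensor R d1 d2 d3).
Hypotheses (UsUs : Us^T *m Us = 1%:M) (VsVs : Vs^T *m Vs = 1%:M).
Hypotheses (UsTs : mode1 (Us *m Us^T) Ts = Ts) (VsTs : mode3 (Vs *m Vs^T) Ts = Ts).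
Hypotheses (Jd1 : (J <= d1)%N) (Kd3 : (K <= d3)%N).

Lemma unfold1_mode3_sup (D : 'M[R]_(K, d3)) : specnorm (unfold1 (mode3 D E)) <= specnorm D *
  sup [set specnorm (unfold1 (mode3 V^T E))
      | V in [set V : 'M[R]_(d3, K) | specnorm V <= 1]].
Proof.
apply: (@specnorm_le_sup _ _ (fun D => specnorm (unfold1 (mode3 D E)))
  (specnorm (unfold1 E))) => [{}D||a {}D|{}D]; try exact: specnorm_ge0.
  suff -> : unfold1 (mode3 (a *: D) E) = a *: unfold1 (mode3 D E).
    exact: specnormZ_le.
  apply/matrixP => i j; rewrite !mxE mulr_sumr; apply: eq_bigr => l _.
  by rewrite mxE mulrA.
exact: specnorm_unfold1_mode3.
Qed.

Lemma unfold3_mode1_sup (D : 'M[R]_(J, d1)) : specnorm (unfold3 (mode1 D E)) <= specnorm D *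
  sup [set specnorm (unfold3 (mode1 U^T E))
      | U in [set U : 'M[R]_(d1, J) | specnorm U <= 1]].
Proof.
apply: (@specnorm_le_sup _ _ (fun D => specnorm (unfold3 (mode1 D E)))
  (specnorm (unfold3 E))) => [{}D||a {}D|{}D]; try exact: specnorm_ge0.
  suff -> : unfold3 (mode1 (a *: D) E) = a *: unfold3 (mode1 D E).
    exact: specnormZ_le.
  apply/matrixP => i j; rewrite !mxE mulr_sumr; apply: eq_bigr => l _.
  by rewrite mxE mulrA.
exact: specnorm_unfold3_mode1.
Qed.

(** [small_angle_cos] lifted to tensors whose mode-3 fibres lie in the range of [Vs]: compressing
    them by [V^T] loses little norm. *)
Lemma tfnorm_mode3_small_angle n1 n2 (V : 'M[R]_(d3, K)) (X : tensor R n1 n2 d3) :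
  V^T *m V = 1%:M -> specnorm ((1%:M - V *m V^T) *m Vs) <= 1 / 11 ->
  mode3 (Vs *m Vs^T) X = X -> tfnorm X <= 101 / 100 * tfnorm (mode3 V^T X).
Proof.
move=> VV small XE; rewrite -{2}XE -mode3M [in leRHS]mode3M -{1}XE -mode3M.
rewrite tfnorm_mode3_isom // -!mxfnorm_unfold3 -[in leRHS]mulmx_unfold3.
by apply: mxfnorm_le_mul; [lra | exact: small_angle_cos].
Qed.

Lemma tfnorm_mode1_small_angle n2 n3 (U : 'M[R]_(d1, J)) (X : tensor R d1 n2 n3) :
  U^T *m U = 1%:M -> specnorm ((1%:M - U *m U^T) *m Us) <= 1 / 11 ->
  mode1 (Us *m Us^T) X = X -> tfnorm X <= 101 / 100 * tfnorm (mode1 U^T X).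
Proof.
move=> UU small XE; rewrite -{2}XE -mode1M [in leRHS]mode1M -{1}XE -mode1M.
rewrite tfnorm_mode1_isom // -!mxfnorm_unfold1 -[in leRHS]mulmx_unfold1.
by apply: mxfnorm_le_mul; [lra | exact: small_angle_cos].
Qed.

Lemma rank_unfold1_mode3 p (A : 'M[R]_(p, d3)) :
  (\rank (unfold1 (mode3 A Ts)) <= J)%N.
Proof.
rewrite -UsTs -mode1M -mode1_mode3 -mulmx_unfold1.
by rewrite (leq_trans (mxrankM_maxl _ _)) ?rank_leq_col.
Qed.

Lemma rank_unfold3_mode1 p (A : 'M[R]_(p, d1)) :
  (\rank (unfold3 (mode1 A Ts)) <= K)%N.
Proof.
rewrite -VsTs -mode3M mode1_mode3 -mulmx_unfold3.
by rewrite (leq_trans (mxrankM_maxl _ _)) ?rank_leq_col.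
Qed.

Lemma initial_step1 (U : 'M[R]_(d1, J)) :
  leading_lsv (unfold1 (tadd Ts E)) U ->
  specnorm (unfold1 (mode1 (1%:M - U *m U^T) Ts)) <= 2 * specnorm (unfold1 E).
Proof.
rewrite -mulmx_unfold1 unfold1D; apply: leading_lsv_specnorm => //.
by rewrite -[Ts]mode3_1 rank_unfold1_mode3.
Qed.

(** The perturbation bound concerns the tensor compressed by [V^T]. Undoing the compression costs
    the cosine factor, so the constant is 2 (101/100) = 101/50. *)
Lemma iteration_step1 (V : 'M[R]_(d3, K)) (U : 'M[R]_(d1, J)) :
  V^T *m V = 1%:M -> specnorm ((1%:M - V *m V^T) *m Vs) <= 1 / 11 ->
  leading_lsv (unfold1 (mode3 V^T (tadd Ts E))) U ->
  specnorm (unfold1 (mode1 (1%:M - U *m U^T) Ts))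
  <= 101 / 50 * specnorm (unfold1 (mode3 V^T E)).
Proof.
move=> VV small; rewrite mode3D unfold1D => lsv.
have := leading_lsv_specnorm Jd1 (rank_unfold1_mode3 V^T) lsv.
rewrite mulmx_unfold1; set X := mode1 _ (mode3 _ _) => Xle.
suff : specnorm (unfold1 (mode1 (1%:M - U *m U^T) Ts))
    <= 101 / 100 * specnorm (unfold1 X) by lra.
apply: specnorm_unfold1_le => [|y]; first by lra.
rewrite /X !mode1_mode3; apply: tfnorm_mode3_small_angle => //.
by rewrite -!mode1_mode3 VsTs.
Qed.

Lemma iteration_step3 (U : 'M[R]_(d1, J)) (V : 'M[R]_(d3, K)) :
  U^T *m U = 1%:M -> specnorm ((1%:M - U *m U^T) *m Us) <= 1 / 11 ->
  leading_lsv (unfold3 (mode1 U^T (tadd Ts E))) V ->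
  specnorm (unfold3 (mode3 (1%:M - V *m V^T) Ts))
  <= 101 / 50 * specnorm (unfold3 (mode1 U^T E)).
Proof.
move=> UU small; rewrite mode1D unfold3D => lsv.
have := leading_lsv_specnorm Kd3 (rank_unfold3_mode1 U^T) lsv.
rewrite mulmx_unfold3; set X := mode3 _ (mode1 _ _) => Xle.
suff : specnorm (unfold3 (mode3 (1%:M - V *m V^T) Ts))
    <= 101 / 100 * specnorm (unfold3 X) by lra.
apply: specnorm_unfold3_le => [|y]; first by lra.
rewrite /X -!mode1_mode3; apply: tfnorm_mode1_small_angle => //.
by rewrite !mode1_mode3 UsTs.
Qed.

(** In the splitting of [V^T], the part through [Vs^T] meets the aligned noise, and the remainder,
    of the size of the sine, meets the worst-case noise [b]. *)
Lemma noise1_le (V : 'M[R]_(d3, K)) x b :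
  V^T *m V = 1%:M -> specnorm ((1%:M - V *m V^T) *m Vs) <= x -> x <= 1 / 11 ->
  0 <= b ->
  (forall D : 'M[R]_(K, d3), specnorm (unfold1 (mode3 D E)) <= specnorm D * b) ->
  specnorm (unfold1 (mode3 V^T E))
  <= 101 / 100 * (specnorm (unfold1 (mode3 Vs^T E)) + x * b).
Proof.
move=> VV hx x11 b0 hb; have [C [D [-> C1 D1]]] := small_angle_split VV VsVs hx x11.
rewrite mode3Dl unfold1D -mode3M mulrDr; apply: le_trans (specnormD _ _) _.
rewrite lerD //.
  apply: le_trans (specnorm_unfold1_mode3 _ _) _.
  by rewrite ler_wpM2r ?specnorm_ge0.
by apply: le_trans (hb _) _; rewrite mulrA ler_wpM2r.
Qed.

Lemma noise3_le (U : 'M[R]_(d1, J)) x b :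
  U^T *m U = 1%:M -> specnorm ((1%:M - U *m U^T) *m Us) <= x -> x <= 1 / 11 ->
  0 <= b ->
  (forall D : 'M[R]_(J, d1), specnorm (unfold3 (mode1 D E)) <= specnorm D * b) ->
  specnorm (unfold3 (mode1 U^T E))
  <= 101 / 100 * (specnorm (unfold3 (mode1 Us^T E)) + x * b).
Proof.
move=> UU hx x11 b0 hb; have [C [D [-> C1 D1]]] := small_angle_split UU UsUs hx x11.
rewrite mode1Dl unfold3D -mode1M mulrDr; apply: le_trans (specnormD _ _) _.
rewrite lerD //.
  apply: le_trans (specnorm_unfold3_mode1 _ _) _.
  by rewrite ler_wpM2r ?specnorm_ge0.
by apply: le_trans (hb _) _; rewrite mulrA ler_wpM2r.
Qed.

(* The part of the noise outside [Us] is kept in Frobenius norm: its spectral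
   norm is only controlled by [sqrt J * specnorm (unfold1 E)], and multiplying
   that by [sqrt K] would be too much. *)
Lemma last_step3 (U : 'M[R]_(d1, J)) (V : 'M[R]_(d3, K)) x :
  U^T *m U = 1%:M -> specnorm ((1%:M - U *m U^T) *m Us) <= x -> x <= 1 / 11 ->
  leading_lsv (unfold3 (mode1 U^T (tadd Ts E))) V ->
  tfnorm (mode3 (1%:M - V *m V^T) Ts)
  <= 10201 / 5000 * (Num.sqrt K%:R * specnorm (unfold3 (mode1 Us^T E))
                     + Num.sqrt J%:R * x * specnorm (unfold1 E)).
Proof.
move=> UU hx x11; have [C [D [UE C1 D1]]] := small_angle_split UU UsUs hx x11.
rewrite mode1D unfold3D [in X in _ + X]UE mode1Dl unfold3D => lsv.
have rA := rank_unfold3_mode1 U^T.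
have [W1 [W2 [WE W1le W2le]]] := leading_lsv_perturbation Kd3 rA lsv.
have Z1le : specnorm (unfold3 (mode1 (C *m Us^T) E))
    <= 101 / 100 * specnorm (unfold3 (mode1 Us^T E)).
  rewrite -mode1M; apply: le_trans (specnorm_unfold3_mode1 _ _) _.
  by rewrite ler_wpM2r ?specnorm_ge0.
(* [D] has [J] rows, so its Frobenius norm is at most sqrt J times its spectral norm. Passing to the
   mode-1 unfolding pairs it with the spectral norm of [unfold1 E]. *)
have Z2le : mxfnorm (unfold3 (mode1 D E))
    <= 101 / 100 * (Num.sqrt J%:R * x * specnorm (unfold1 E)).
  rewrite mxfnorm_unfold3 -mxfnorm_unfold1 -mulmx_unfold1.
  apply: le_trans (specnormMr _ _) _; rewrite mulrA ler_wpM2r ?specnorm_ge0 //.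
  apply: le_trans (mxfnorm_le_specnorm _) _.
  by rewrite mulrCA ler_wpM2l ?sqrtr_ge0.
have rW : (\rank ((1%:M - V *m V^T) *m unfold3 (mode1 U^T Ts)) <= K)%N.
  by rewrite (leq_trans (mxrankM_maxr _ _)).
have := low_rank_mxfnorm_le rW WE.
rewrite mulmx_unfold3 mxfnorm_unfold3 -mode1_mode3 => Wle.
have sK : 0 <= Num.sqrt K%:R :> R by exact: sqrtr_ge0.
have Tle : tfnorm (mode3 (1%:M - V *m V^T) Ts)
    <= 101 / 100 * tfnorm (mode1 U^T (mode3 (1%:M - V *m V^T) Ts)).
  apply: tfnorm_mode1_small_angle => //; first exact: le_trans hx x11.
  by rewrite mode1_mode3 UsTs.
have W1K : Num.sqrt K%:R * specnorm W1
    <= 101 / 50 * (Num.sqrt K%:R * specnorm (unfold3 (mode1 Us^T E))).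
  by rewrite mulrCA ler_wpM2l //; lra.
lra.
Qed.

(** The residual keeps rank at most [J], so [low_rank_mxfnorm_le] applies with a zero Frobenius
    part. *)
Lemma tfnorm_residual1_le (U : 'M[R]_(d1, J)) :
  tfnorm (mode1 (1%:M - U *m U^T) Ts)
  <= Num.sqrt J%:R * specnorm (unfold1 (mode1 (1%:M - U *m U^T) Ts)).
Proof.
set X := mode1 _ _; have rX : (\rank (unfold1 X) <= J)%N.
  by rewrite -[X]mode3_1 /X -mode1_mode3 -mulmx_unfold1
    (leq_trans (mxrankM_maxr _ _)) ?rank_unfold1_mode3.
have := low_rank_mxfnorm_le rX (esym (addr0 (unfold1 X))).
by rewrite mxfnorm0 addr0 mxfnorm_unfold1.
Qed.

End PowerIterationStep.

(** * Splitting the estimation error *)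

Section ErrorDecomposition.
Variable R : realType.

Lemma tsub_mode1 m n2 n3 (P : 'M[R]_m) (X : tensor R m n2 n3) :
  mode1 (1%:M - P) X = tsub X (mode1 P X).
Proof.
by apply: unfold1_inj; rewrite unfold1B -!mulmx_unfold1 mulmxBl mul1mx.
Qed.

Lemma tsub_mode3 m n1 n2 (P : 'M[R]_m) (X : tensor R n1 n2 m) :
  mode3 (1%:M - P) X = tsub X (mode3 P X).
Proof.
apply: unfold3_inj; rewrite -!mulmx_unfold3 mulmxBl mul1mx mulmx_unfold3.
by apply/matrixP => i j; rewrite !mxE.
Qed.

Lemma mode1B m n1 n2 n3 (M : 'M[R]_(m, n1)) (X Y : tensor R n1 n2 n3) :
  mode1 M (tsub X Y) = tsub (mode1 M X) (mode1 M Y).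
Proof. by apply: unfold1_inj; rewrite unfold1B -!mulmx_unfold1 unfold1B mulmxBr. Qed.

Lemma tfnormB n1 n2 n3 (X Y : tensor R n1 n2 n3) :
  tfnorm (tsub X Y) <= tfnorm X + tfnorm Y.
Proof. by rewrite -!mxfnorm_unfold1 unfold1B mxfnormB. Qed.

(** The error is P_U P_V E - P_U (1 - P_V) X - (1 - P_U) X. The isometries preserve the norm of the
    first term, and P_U does not increase that of the second. *)
Lemma projection_error_le d1 d2 d3 J K (U : 'M[R]_(d1, J)) (V : 'M[R]_(d3, K))
    (X E : tensor R d1 d2 d3) :
  U^T *m U = 1%:M -> V^T *m V = 1%:M ->
  tfnorm (tsub (mode1 U (mode3 V (mode1 U^T (mode3 V^T (tadd X E))))) X)
  <= tfnorm (mode1 U^T (mode3 V^T E)) + tfnorm (mode3 (1%:M - V *m V^T) X)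
     + tfnorm (mode1 (1%:M - U *m U^T) X).
Proof.
move=> UU VV; set X3 := mode3 (1%:M - _) X; set X1 := mode1 (1%:M - _) X.
pose N := mode1 U (mode3 V (mode1 U^T (mode3 V^T E))).
have -> : tsub (mode1 U (mode3 V (mode1 U^T (mode3 V^T (tadd X E))))) X
    = tsub (tsub N (mode1 U (mode1 U^T X3))) X1.
  rewrite /N /X1 /X3 tsub_mode1 tsub_mode3. rewrite !mode1B mode3D mode1D mode3D mode1D.
  rewrite -!mode1_mode3 !mode1M !mode3M.
  by apply/funext => a; apply/funext => b; apply/funext => c; rewrite /tsub /tadd; ring.
apply: le_trans (tfnormB _ _) _; rewrite lerD2r.
apply: le_trans (tfnormB _ _) _; apply: lerD.
  by rewrite /N tfnorm_mode1_isom // tfnorm_mode3_isom.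
rewrite tfnorm_mode1_isom //; apply: le_trans (tfnorm_mode1_le _ _) _.
by rewrite specnorm_tr ler_piMl ?specnorm_isom_le // -mxfnorm_unfold1 mxfnorm_ge0.
Qed.

Lemma leading_lsv_exact m n k (A : 'M[R]_(m, n)) (U : 'M[R]_(m, k)) :
  (k <= m)%N -> (\rank A <= k)%N -> leading_lsv A U -> U *m U^T *m A = A.
Proof.
move=> km rA; rewrite -{1}[A]addr0 => /(leading_lsv_specnorm km rA).
rewrite specnorm0 mulr0 => /specnorm_le0; rewrite mulmxBl mul1mx => /eqP.
by rewrite subr_eq0 => /eqP <-.
Qed.

End ErrorDecomposition.

(** * The scalar recursion and the numerical constants *)

Section ScalarEstimates.
Variable R : realType.

(** The fixed point L / (1 - rho) is at most (101/100) L because rho <= 1/101, and the initial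
    excess contracts by [rho] at each step. *)
Lemma affine_recursion_le (u : nat -> R) L rho n N : 0 <= L -> 0 <= rho ->
  rho <= 1 / 101 -> 0 <= n -> u 0%N <= 2 * n ->
  (forall t, (t < N)%N -> u t.+1 <= L + rho * u t) ->
  forall t, (t <= N)%N -> u t <= 101 / 100 * L + 2 * (rho ^+ t * n).
Proof.
move=> L0 r0 r1 n0 u0 uS; elim=> [_|t IHt tN].
  by rewrite expr0 mul1r; lra.
apply: le_trans (uS t tN) _; have := ler_wpM2l r0 (IHt (ltnW tN)).
rewrite exprS; have : rho * L <= 1 / 101 * L by rewrite ler_wpM2r.
move: (rho ^+ t) => e; lra.
Qed.

(** As 24 n <= sJ, the product (u / sJ) n is at most u / 24, so [u] enters with a total factor below
    1.09. Inserting the bound on [u] gives coefficients below 2.3 for [aU], 4.6 for [z] and 2.2 for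
    [q], within the allowed 4, 48 and 3. *)
Lemma final_estimate (qJ qK aU aV sJ n u q q' w z : R) :
  0 <= qJ -> 0 <= qK -> 0 <= aU -> 0 <= aV -> 0 <= u -> 0 <= w -> 0 <= z ->
  0 <= n -> 0 < sJ -> 24 * n <= sJ -> 0 <= q -> q <= q' ->
  u <= 101 / 100 * (10201 / 5000 * aU + (10201 / 5000) ^+ 2 * z) + 2 * q ->
  10201 / 5000 * (qK * aV + qJ * (u / sJ) * n) + qJ * u
  <= 4 * qK * aV + 4 * qJ * aU + 48 * (qK * w + qJ * z) + 3 * (qJ + qK) * q'.
Proof.
move=> J0 K0 aU0 aV0 u0 w0 z0 n0 sJ0 nsJ q0 qq' ule.
have un : u / sJ * n <= u / 24.
  rewrite -mulrA ler_wpM2l // mulrC ler_pdivrMr //; lra.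
have : qJ * (u / sJ * n) <= qJ * (u / 24) by rewrite ler_wpM2l.
have := ler_wpM2l J0 ule; have := ler_wpM2l J0 qq'.
have := mulr_ge0 J0 aU0; have := mulr_ge0 K0 aV0; have := mulr_ge0 J0 z0.
have := mulr_ge0 K0 w0; have := mulr_ge0 J0 q0.
have := mulr_ge0 K0 (le_trans q0 qq').
rewrite -(mulrA qJ (u / sJ)); move: (qJ * (u / sJ * n)) => y; lra.
Qed.

Lemma contraction_constants :
  [/\ 0 <= 10201 / 5000 :> R, (10201 / 5000) ^+ 2 <= 64 :> R &
      (10201 / 5000) ^+ 2 * (1 / 24 * (1 / 24)) <= 1 / 101 :> R].
Proof. by split; lra. Qed.

End ScalarEstimates.

(** * Residuals along the iteration *)

Section HardTTh.
Variables (R : realType) (d1 d2 d3 J K T : nat).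
Variables (Us : 'M[R]_(d1, J)) (Vs : 'M[R]_(d3, K)) (Ts E : tensor R d1 d2 d3).
Variables (Uh : nat -> 'M[R]_(d1, J)) (Vh : nat -> 'M[R]_(d3, K)).
Local Notation Y := (tadd Ts E).
Hypotheses (J0 : (0 < J)%N) (K0 : (0 < K)%N) (Jd1 : (J <= d1)%N) (Kd3 : (K <= d3)%N).
Hypotheses (UsUs : Us^T *m Us = 1%:M) (VsVs : Vs^T *m Vs = 1%:M).
Hypotheses (UsTs : mode1 (Us *m Us^T) Ts = Ts) (VsTs : mode3 (Vs *m Vs^T) Ts = Ts).
Hypothesis lsvU0 : leading_lsv (unfold1 Y) (Uh 0%N).
Hypothesis lsvU : forall t, (t < T)%N -> leading_lsv (unfold1 (mode3 (Vh t)^T Y)) (Uh t.+1).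
Hypothesis lsvV : forall t, (t <= T)%N -> leading_lsv (unfold3 (mode1 (Uh t)^T Y)) (Vh t).

Lemma Uh_isom t : (t <= T)%N -> (Uh t)^T *m Uh t = 1%:M.
Proof.
by case: t => [_|t tT]; [exact: leading_lsv_isom lsvU0 | exact: leading_lsv_isom (lsvU tT)].
Qed.

Lemma Vh_isom t : (t <= T)%N -> (Vh t)^T *m Vh t = 1%:M.
Proof. by move=> tT; exact: leading_lsv_isom (lsvV tT). Qed.

(** Without noise the residual bounds vanish, so each new projection fixes the compressed tensor.
    Expanding back by the other frame recovers [Ts], since that frame's projection already fixes
    [Ts]. *)
Lemma noiseless_recovery : E = (fun _ _ _ => 0) -> forall t, (t <= T)%N ->
  mode1 (Uh t *m (Uh t)^T) Ts = Ts /\ mode3 (Vh t *m (Vh t)^T) Ts = Ts.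
Proof.
move=> E0; have YE : Y = Ts.
  rewrite E0; apply/funext => a; apply/funext => b; apply/funext => c.
  by rewrite /tadd addr0.
have stepV t : (t <= T)%N -> mode1 (Uh t *m (Uh t)^T) Ts = Ts ->
    mode3 (Vh t *m (Vh t)^T) Ts = Ts.
  move=> tT UTs; have := lsvV tT; rewrite YE.
  move=> /(leading_lsv_exact Kd3 (rank_unfold3_mode1 VsTs _)).
  rewrite mulmx_unfold3 -mode1_mode3 => /(@unfold3_inj R) /(congr1 (mode1 (Uh t))).
  by rewrite !mode1M mode1_mode3 UTs.
elim=> [|t IHt] tT.
  have U0 : mode1 (Uh 0%N *m (Uh 0%N)^T) Ts = Ts.
    have rTs : (\rank (unfold1 Ts) <= J)%N.
      by rewrite -[Ts]mode3_1 (rank_unfold1_mode3 UsTs).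
    have := lsvU0; rewrite YE => /(leading_lsv_exact Jd1 rTs).
    by rewrite mulmx_unfold1 => /(@unfold1_inj R).
  by split; last exact: stepV.
have [_ VTs] := IHt (ltnW tT).
have UTs : mode1 (Uh t.+1 *m (Uh t.+1)^T) Ts = Ts.
  have := lsvU tT; rewrite YE.
  move=> /(leading_lsv_exact Jd1 (rank_unfold1_mode3 UsTs _)).
  rewrite mulmx_unfold1 mode1_mode3 => /(@unfold1_inj R) /(congr1 (mode3 (Vh t))).
  by rewrite !mode3M -mode1_mode3 VTs.
by split; last exact: stepV.
Qed.

Let sJ := sing_val (unfold1 Ts) J.
Let sK := sing_val (unfold3 Ts) K.
Let nE := specnorm (unfold1 E).
Let aU := specnorm (unfold1 (mode3 Vs^T E)).
Let aV := specnorm (unfold3 (mode1 Us^T E)).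
Let u t := specnorm (unfold1 (mode1 (1%:M - Uh t *m (Uh t)^T) Ts)).
Let v t := specnorm (unfold3 (mode3 (1%:M - Vh t *m (Vh t)^T) Ts)).

Variables bU bV : R.
Hypotheses (bU0 : 0 <= bU) (bV0 : 0 <= bV) (bUE : bU <= nE).
Hypothesis bUP :
  forall D : 'M[R]_(K, d3), specnorm (unfold1 (mode3 D E)) <= specnorm D * bU.
Hypothesis bVP :
  forall D : 'M[R]_(J, d1), specnorm (unfold3 (mode1 D E)) <= specnorm D * bV.
Hypotheses (sJ0 : 0 < sJ) (sK0 : 0 < sK) (sJE : 24 * nE <= sJ) (sKE : 24 * bV <= sK).

Lemma sinU_le t :
  specnorm ((1%:M - Uh t *m (Uh t)^T) *m Us) <= u t / sJ.
Proof.
have TsE : unfold1 Ts = Us *m (Us^T *m unfold1 Ts).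
  by rewrite mulmxA mulmx_unfold1 UsTs.
rewrite ler_pdivlMr // /u -mulmx_unfold1 /sJ TsE sing_val_specnorm //.
by rewrite -TsE ltW.
Qed.

Lemma sinV_le t :
  specnorm ((1%:M - Vh t *m (Vh t)^T) *m Vs) <= v t / sK.
Proof.
have TsE : unfold3 Ts = Vs *m (Vs^T *m unfold3 Ts).
  by rewrite mulmxA mulmx_unfold3 VsTs.
rewrite ler_pdivlMr // /v -mulmx_unfold3 /sK TsE sing_val_specnorm //.
by rewrite -TsE ltW.
Qed.

(** Two bounds on one half-step. The crude noise bound bV <= sK / 24 gives a ratio of at most
    (101/50) / 24 < 1/11, which keeps the iteration in the small-angle regime; the splitting of the
    frame gives the sharper estimate. *)
Lemma residualV_le t : (t <= T)%N -> u t / sJ <= 1 / 11 ->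
  v t / sK <= 1 / 11 /\ v t <= 10201 / 5000 * (aV + u t / sJ * bV).
Proof.
move=> tT small; have UU := Uh_isom tT.
have vle := iteration_step3 UsUs UsTs VsTs Kd3 UU (le_trans (sinU_le t) small) (lsvV tT).
have := noise3_le UsUs UU (sinU_le t) small bV0 bVP.
have le_bV : specnorm (unfold3 (mode1 (Uh t)^T E)) <= bV.
  apply: le_trans (bVP _) _.
  by rewrite ler_piMl // specnorm_tr specnorm_isom_le.
move: vle; rewrite -/(v t) -/aV => vle; split; last by lra.
rewrite ler_pdivrMr //; move: vle le_bV sKE (ltW sK0).
by move: (v t) (specnorm (unfold3 _)) bV sK => *; lra.
Qed.

Lemma residualU_le t : (t < T)%N -> v t / sK <= 1 / 11 ->
  u t.+1 / sJ <= 1 / 11 /\ u t.+1 <= 10201 / 5000 * (aU + v t / sK * bU).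
Proof.
move=> tT small; have VV := Vh_isom (ltnW tT).
have ule := iteration_step1 VsVs UsTs VsTs Jd1 VV (le_trans (sinV_le t) small) (lsvU tT).
have := noise1_le VsVs VV (sinV_le t) small bU0 bUP.
have le_nE : specnorm (unfold1 (mode3 (Vh t)^T E)) <= nE.
  apply: le_trans (specnorm_unfold1_mode3 _ _) _.
  by rewrite ler_piMl ?specnorm_ge0 // specnorm_tr specnorm_isom_le.
move: ule; rewrite -/(u t.+1) -/aU => ule; split; last by lra.
rewrite ler_pdivrMr //; move: ule le_nE sJE (ltW sJ0).
by move: (u _) (specnorm (unfold1 (mode3 _ _))) nE sJ => *; lra.
Qed.

Lemma residual_init : u 0%N <= 2 * nE.
Proof. exact (initial_step1 UsTs Jd1 lsvU0). Qed.

Lemma residuals_small t : (t <= T)%N -> u t / sJ <= 1 / 11 /\ v t / sK <= 1 / 11.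
Proof.
elim: t => [|t IHt] tT.
  have U0 : u 0%N / sJ <= 1 / 11.
    (* The initial ratio is at most 2/24 = 1/12. *)
    rewrite ler_pdivrMr //; move: residual_init sJE (ltW sJ0).
    by move: (u _) nE sJ => *; lra.
  exact: conj U0 (proj1 (residualV_le tT U0)).
have [_ Vt] := IHt (ltnW tT); have Ut := proj1 (residualU_le tT Vt).
exact: conj Ut (proj1 (residualV_le tT Ut)).
Qed.

(** The sharp bound on [v t] is substituted into the one on [u t.+1], leaving a recursion in [u]
    alone. *)
Lemma residual_recursion t : (t < T)%N ->
  u t.+1 <= 10201 / 5000 * aU + (10201 / 5000) ^+ 2 * (bU * aV / sK)
            + (10201 / 5000) ^+ 2 * (bU * bV / (sJ * sK)) * u t.
Proof.
move=> tT; have [Ut Vt] := residuals_small (ltnW tT).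
have [_ vle] := residualV_le (ltnW tT) Ut; have [_ ule] := residualU_le tT Vt.
apply: le_trans ule _.
have c0 : 0 <= bU / sK by rewrite divr_ge0 // ltW.
have h : v t / sK * bU <= 10201 / 5000 * (aV + u t / sJ * bV) * (bU / sK).
  by rewrite mulrAC -mulrA ler_wpM2r.
have -> : 10201 / 5000 * aU + (10201 / 5000) ^+ 2 * (bU * aV / sK)
      + (10201 / 5000) ^+ 2 * (bU * bV / (sJ * sK)) * u t
    = 10201 / 5000 * (aU + 10201 / 5000 * (aV + u t / sJ * bV) * (bU / sK)).
  by field; rewrite !gt_eqF.
by rewrite ler_wpM2l ?lerD2l //; lra.
Qed.

(** The last mode-1 residual is handled by its rank and the solved recursion, the last mode-3
    residual by [last_step3]. *)
Lemma residual_total_le :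
  tfnorm (mode3 (1%:M - Vh T *m (Vh T)^T) Ts)
  + tfnorm (mode1 (1%:M - Uh T *m (Uh T)^T) Ts)
  <= 4 * Num.sqrt K%:R * aV + 4 * Num.sqrt J%:R * aU
     + 48 * (Num.sqrt K%:R * (bV * aU / sJ) + Num.sqrt J%:R * (bU * aV / sK))
     + 3 * (Num.sqrt J%:R + Num.sqrt K%:R)
       * ((64 * bV * bU / (sJ * sK)) ^+ T * nE).
Proof.
have [UT _] := residuals_small (leqnn T).
have := last_step3 UsUs UsTs VsTs Kd3 (Uh_isom (leqnn T)) (sinU_le T) UT
  (lsvV (leqnn T)).
have := tfnorm_residual1_le UsTs (Uh T); rewrite -/(u T) -/aV -/nE.
move=> U_le V_le; apply: le_trans (lerD V_le U_le) _.
have nE0 : 0 <= nE := specnorm_ge0 _.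
have aU0 : 0 <= aU := specnorm_ge0 _.
have aV0 : 0 <= aV := specnorm_ge0 _.
pose e := bU * bV / (sJ * sK).
have e0 : 0 <= e by rewrite !(mulr_ge0, invr_ge0, divr_ge0) // ltW.
(* [e] is the product of the ratios bU / sJ and bV / sK, each at most 1/24; for the first this
   passes through [bUE]. *)
have e1 : e <= 1 / 24 * (1 / 24).
  have -> : e = bU / sJ * (bV / sK) by rewrite /e; field; rewrite !gt_eqF.
  rewrite ler_pM ?divr_ge0 ?(ltW sJ0) ?(ltW sK0) // ler_pdivrMr //.
    by move: bUE sJE; move: nE sJ => *; lra.
  by move: sKE; move: sK => *; lra.
have r0 : 0 <= (10201 / 5000) ^+ 2 * e by exact: mulr_ge0 (sqr_ge0 _) e0.
have [c0 k64 k101] := contraction_constants R.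
have z0 : 0 <= bU * aV / sK by rewrite divr_ge0 ?mulr_ge0 // ltW.
apply: (@final_estimate _ _ _ aU aV sJ nE (u T)
  (((10201 / 5000) ^+ 2 * e) ^+ T * nE)); rewrite ?sqrtr_ge0 ?specnorm_ge0 //.
- by rewrite divr_ge0 ?mulr_ge0 // ltW.
- exact: mulr_ge0 (exprn_ge0 _ r0) nE0.
(* The contraction constant (10201/5000)^2 is relaxed to 64 before taking powers. *)
- have -> : 64 * bV * bU / (sJ * sK) = 64 * e by rewrite /e; field; rewrite !gt_eqF.
  have r64 : (10201 / 5000) ^+ 2 * e <= 64 * e by exact: (ler_wpM2r e0 k64).
  apply: ler_wpM2r => //; apply: lerXn2r r64; rewrite nnegrE //.
  exact: mulr_ge0 (ler0n _ _) e0.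
- apply: (@affine_recursion_le _ u _ _ _ T) => //.
  + exact: addr_ge0 (mulr_ge0 c0 aU0) (mulr_ge0 (sqr_ge0 _) z0).
  + exact: le_trans (ler_wpM2l (sqr_ge0 _) e1) k101.
  + exact: residual_init.
  + exact: residual_recursion.
Qed.

End HardTTh.

(** * Assembly of the error bound *)

Unset Implicit Arguments.

Theorem theorem2 (R : realType) (d1 d2 d3 J K T : nat)
  (hd1 : (0 < d1)%N) (hd2 : (0 < d2)%N) (hd3 : (0 < d3)%N)
  (hJ : (0 < J)%N) (hK : (0 < K)%N) (hJd : (J <= d1)%N) (hKd : (K <= d3)%N)
  (hT : (0 < T)%N)
  (Us : 'M[R]_(d1, J)) (Vs : 'M[R]_(d3, K)) (Ws : tensor R J d2 K)
  (E : tensor R d1 d2 d3) (That : tensor R d1 d2 d3) :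
  orthonormal_cols Us -> orthonormal_cols Vs ->
  let Ts := mode1 Us (mode3 Vs Ws) in
  let Y := tadd Ts E in
  hardtth_output Y J K T That ->
  let sJ := sing_val (unfold1 Ts) J in
  let sK := sing_val (unfold3 Ts) K in
  let nE := specnorm (unfold1 E) in
  sJ >= 24 * nE ->
  sK >= 24 * sup [set specnorm (unfold3 E *m (U *t (1%:M : 'M[R]_d2)))
                   | U in [set U : 'M[R]_(d1, J) | specnorm U <= 1]] ->
  let alphaU := specnorm (unfold1 (mode3 Vs^T E)) in
  let betaU := sup [set specnorm (unfold1 (mode3 V^T E))
                   | V in [set V : 'M[R]_(d3, K) | specnorm V <= 1]] in
  let alphaV := specnorm (unfold3 (mode1 Us^T E)) in
  let betaV := sup [set specnorm (unfold3 (mode1 U^T E))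
                   | U in [set U : 'M[R]_(d1, J) | specnorm U <= 1]] in
  let diam2 := 48 * (Num.sqrt K%:R * betaV * alphaU / sJ
                     + Num.sqrt J%:R * betaU * alphaV / sK) in
  let rT := 3 * (Num.sqrt J%:R + Num.sqrt K%:R)
            * (64 * betaV * betaU / (sJ * sK)) ^+ T * nE in
  tfnorm (tsub That Ts) <=
    sup [set tfnorm (mode1 UV.1^T (mode3 UV.2^T E))
        | UV in [set UV : 'M[R]_(d1, J) * 'M[R]_(d3, K)
                 | orthonormal_cols UV.1 /\ orthonormal_cols UV.2]]
    + 4 * Num.sqrt K%:R * alphaV + 4 * Num.sqrt J%:R * alphaU + diam2 + rT.
Proof.
move=> UsUs VsVs Ts Y [Uh [Vh [lsvU0 lsvV0 lsvUV ThatE]]] sJ sK nE hJE hKE.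
pose alphaU := specnorm (unfold1 (mode3 Vs^T E)).
pose betaU := sup [set specnorm (unfold1 (mode3 V^T E))
                  | V in [set V : 'M[R]_(d3, K) | specnorm V <= 1]].
pose alphaV := specnorm (unfold3 (mode1 Us^T E)).
pose betaV := sup [set specnorm (unfold3 (mode1 U^T E))
                  | U in [set U : 'M[R]_(d1, J) | specnorm U <= 1]].
set sup_noise := sup [set tfnorm _ | _ in _].
change (tfnorm (tsub That Ts) <= sup_noise
  + 4 * Num.sqrt K%:R * alphaV + 4 * Num.sqrt J%:R * alphaU
  + 48 * (Num.sqrt K%:R * betaV * alphaU / sJ + Num.sqrt J%:R * betaU * alphaV / sK)
  + 3 * (Num.sqrt J%:R + Num.sqrt K%:R)
    * (64 * betaV * betaU / (sJ * sK)) ^+ T * nE).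
have UsTs : mode1 (Us *m Us^T) Ts = Ts by rewrite /Ts mode1M -mulmxA UsUs mulmx1.
have VsTs : mode3 (Vs *m Vs^T) Ts = Ts.
  by rewrite /Ts -mode1_mode3 mode3M -mulmxA VsVs mulmx1.
have lsvU t : (t < T)%N -> leading_lsv (unfold1 (mode3 (Vh t)^T Y)) (Uh t.+1).
  by move=> tT; have [] := lsvUV t.+1 tT.
have lsvV t : (t <= T)%N -> leading_lsv (unfold3 (mode1 (Uh t)^T Y)) (Vh t).
  by case: t => // t tT; have [] := lsvUV t.+1 tT.
have hKE' : 24 * betaV <= sK.
  suff -> : betaV = sup [set specnorm (unfold3 E *m (U *t (1%:M : 'M[R]_d2)))
    | U in [set U : 'M[R]_(d1, J) | specnorm U <= 1]] by [].
  congr sup; congr image; apply/funext => U; by rewrite unfold3_tens.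
have nE0 : 0 <= nE by exact: specnorm_ge0.
have aU0 : 0 <= alphaU by exact: specnorm_ge0.
have aV0 : 0 <= alphaV by exact: specnorm_ge0.
have bU0 : 0 <= betaU.
  apply: le_trans (specnorm_ge0 (unfold1 (mode3 (0 : 'M[R]_(d3, K))^T E))) _.
  apply: ub_le_sup; last by exists 0; rewrite //= specnorm0 ler01.
  exists nE => _ [V /= V1 <-]; apply: le_trans (specnorm_unfold1_mode3 _ _) _.
  by rewrite specnorm_tr ler_piMl.
have bV0 : 0 <= betaV.
  apply: le_trans (specnorm_ge0 (unfold3 (mode1 (0 : 'M[R]_(d1, J))^T E))) _.
  apply: ub_le_sup; last by exists 0; rewrite //= specnorm0 ler01.
  exists (specnorm (unfold3 E)) => _ [U /= U1 <-].
  apply: le_trans (specnorm_unfold3_mode1 _ _) _.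
  by rewrite specnorm_tr ler_piMl // specnorm_ge0.
have bUE : betaU <= nE.
  apply: ge_sup; first by exists (specnorm (unfold1 (mode3 (0 : 'M[R]_(d3, K))^T E))), 0;
    rewrite //= specnorm0 ler01.
  move=> _ [V /= V1 <-]; apply: le_trans (specnorm_unfold1_mode3 _ _) _.
  by rewrite specnorm_tr ler_piMl.
have sJ0 : 0 <= sJ by apply: le_trans hJE; rewrite mulr_ge0.
have sK0 : 0 <= sK by apply: le_trans hKE'; rewrite mulr_ge0.
have UT := Uh_isom hJd lsvU0 lsvU (leqnn T).
have VT := Vh_isom hKd lsvV (leqnn T).
(* The final frames are admissible in the supremum, whose set is bounded because compression by
   orthonormal columns does not increase [tfnorm E]. *)
have noise_le : tfnorm (mode1 (Uh T)^T (mode3 (Vh T)^T E)) <= sup_noise.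
  apply: ub_le_sup; last by exists (Uh T, Vh T).
  exists (tfnorm E) => _ [[U V] /= [UU VV] <-].
  have tE0 : 0 <= tfnorm E by exact: sqrtr_ge0.
  have tVE : tfnorm (mode3 V^T E) <= tfnorm E.
    apply: le_trans (tfnorm_mode3_le _ _) _.
    by rewrite ler_piMl // specnorm_tr specnorm_isom_le.
  apply: le_trans (tfnorm_mode1_le _ _) _; apply: le_trans tVE.
  by rewrite ler_piMl ?sqrtr_ge0 // specnorm_tr specnorm_isom_le.
have error_le := projection_error_le Ts E UT VT.
have ThatE' : That
    = mode1 (Uh T) (mode3 (Vh T) (mode1 (Uh T)^T (mode3 (Vh T)^T Y))) := ThatE.
rewrite ThatE'.
suff total : tfnorm (mode3 (1%:M - Vh T *m (Vh T)^T) Ts)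
    + tfnorm (mode1 (1%:M - Uh T *m (Uh T)^T) Ts)
    <= 4 * Num.sqrt K%:R * alphaV + 4 * Num.sqrt J%:R * alphaU
     + 48 * (Num.sqrt K%:R * (betaV * alphaU / sJ)
             + Num.sqrt J%:R * (betaU * alphaV / sK))
     + 3 * (Num.sqrt J%:R + Num.sqrt K%:R)
       * ((64 * betaV * betaU / (sJ * sK)) ^+ T * nE).
  apply: le_trans error_le _; rewrite -addrA.
  apply: le_trans (lerD noise_le total) _.
  by rewrite !addrA !mulrA.
have noiseless : E = (fun _ _ _ => 0) -> tfnorm (mode3 (1%:M - Vh T *m (Vh T)^T) Ts)
    + tfnorm (mode1 (1%:M - Uh T *m (Uh T)^T) Ts) = 0.
  move=> E0; have [UTs VTs] :=
    noiseless_recovery hJd hKd UsTs VsTs lsvU0 lsvU lsvV E0 (leqnn T).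
  rewrite tsub_mode1 UTs tsub_mode3 VTs -mxfnorm_unfold1 unfold1B subrr mxfnorm0.
  by rewrite addr0.
(* This settles the degenerate cases, where the residuals are zero; a quotient by a vanishing
   singular value is 0 by convention. *)
have rhs_ge0 : 0 <= 4 * Num.sqrt K%:R * alphaV + 4 * Num.sqrt J%:R * alphaU
     + 48 * (Num.sqrt K%:R * (betaV * alphaU / sJ)
             + Num.sqrt J%:R * (betaU * alphaV / sK))
     + 3 * (Num.sqrt J%:R + Num.sqrt K%:R)
       * ((64 * betaV * betaU / (sJ * sK)) ^+ T * nE).
  by rewrite !(addr_ge0, mulr_ge0, exprn_ge0, invr_ge0, sqrtr_ge0, ler0n).
have [sJE|sJ1] := eqVneq sJ 0; [|have [sKE|sK1] := eqVneq sK 0]; last first.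
- have sJgt : 0 < sJ by rewrite lt_def sJ1.
  have sKgt : 0 < sK by rewrite lt_def sK1.
  exact: (residual_total_le hJ hK hJd hKd UsUs VsVs UsTs VsTs lsvU0 lsvU lsvV
    bU0 bV0 bUE (unfold1_mode3_sup E) (unfold3_mode1_sup E) sJgt sKgt hJE hKE').
- rewrite noiseless //; apply/funext => a; apply/funext => b; apply/funext => c.
  have bV_le0 : betaV <= 0 by move: hKE'; rewrite sKE pmulr_rle0.
  (* Here betaV = 0. The matrix unit [D], available since [J] is positive, extracts the slice of [E]
     with first index [a], which must therefore vanish. *)
  pose D : 'M[R]_(J, d1) := delta_mx (Ordinal hJ) a.
  have /specnorm_le0/matrixP/(_ c (mxtens_index (Ordinal hJ, b))) :
      specnorm (unfold3 (mode1 D E)) <= 0.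
    apply: le_trans (unfold3_mode1_sup E D) _.
    by rewrite mulr_ge0_le0 ?specnorm_ge0.
  rewrite !mxE mxtens_indexK /= /mode1 (bigD1 a) //= big1 => [|a' /negPf aa'].
    by rewrite mxE !eqxx mul1r addr0.
  by rewrite mxE aa' andbF mul0r.
(* If sJ = 0, the hypothesis on sigma_J forces [unfold1 E] to be zero. *)
- have nE_le0 : nE <= 0 by move: hJE; rewrite sJE pmulr_rle0.
  rewrite noiseless //; apply: unfold1_inj; rewrite (specnorm_le0 nE_le0).
  by apply/matrixP => i j; rewrite !mxE.
Qed.
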